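(* Let $\alpha>1$ and $\beta\in\mathbb{C}$. The function $F_{\alpha,\beta}(z)=\mathrm{F.p.}\int_0^\infty t^\beta\exp(\mathrm{i}t^\alpha-\mathrm{i}zt)\,\mathrm{d}t$, defined for $\operatorname{Im}z<0$, has an analytic continuation to the whole complex plane, i.e. it extends to an entire function. Moreover this continuation is given, for every $z\in\mathbb{C}$, by $$ \begin{aligned} F_{\alpha,\beta}(z)={}&\mathrm{e}^{\mathrm{i}(\beta+1)\pi/(2\alpha)}\Biggl[\int_1^\infty t^\beta\exp\bigl(-t^\alpha-\mathrm{i}\mathrm{e}^{\mathrm{i}\pi/(2\alpha)}zt\bigr)\,\mathrm{d}t\\ &+\int_0^1t^\beta\Bigl(\exp\bigl(-t^\alpha-\mathrm{i}\mathrm{e}^{\mathrm{i}\pi/(2\alpha)}zt\bigr)-\sum_{m+n\alpha+\operatorname{Re}\beta\le-1}\frac{(-1)^n(-\mathrm{i}z)^m\mathrm{e}^{\mathrm{i}m\pi/(2\alpha)}}{n!\,m!}t^{n\alpha+m}\Bigr)\,\mathrm{d}t\\ &+\sum'_{m+n\alpha+\operatorname{Re}\beta\le-1}\frac{(-1)^n(-\mathrm{i}z)^m\mathrm{e}^{\mathrm{i}m\pi/(2\alpha)}}{n!\,m!}\,\frac{1}{\beta+n\alpha+m+1}\Biggr] +\sum_{m+n\alpha+\beta+1=0}\frac{\mathrm{i}^n(-\mathrm{i}z)^m}{n!\,m!}\,\frac{\pi}{2\alpha}\mathrm{i}. \end{aligned} $$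
   Context: All sums run over pairs of integers $m,n\ge0$ satisfying the indicated condition (these are finite, possibly empty, sums); $\sum'$ means that terms with $\beta+n\alpha+m+1=0$ are omitted. The Hadamard finite part integral ($\mathrm{F.p.}$) is defined, for $\operatorname{Im}z<0$, by $$ \begin{aligned} F_{\alpha,\beta}(z)=\mathrm{F.p.}\int_0^\infty t^\beta \mathrm{e}^{\mathrm{i}t^\alpha-\mathrm{i}zt}\,\mathrm{d}t:={}&\int_1^\infty t^\beta \mathrm{e}^{\mathrm{i}t^\alpha-\mathrm{i}zt}\,\mathrm{d}t+\int_0^1t^\beta\Bigl(\mathrm{e}^{\mathrm{i}t^\alpha-\mathrm{i}zt}-\sum_{m+n\alpha+\operatorname{Re}\beta\le-1}\frac{\mathrm{i}^n(-\mathrm{i}z)^m}{n!\,m!}t^{n\alpha+m}\Bigr)\mathrm{d}t\\ &+\sum'_{m+n\alpha+\operatorname{Re}\beta\le-1}\frac{\mathrm{i}^n(-\mathrm{i}z)^m}{n!\,m!}\,\frac{1}{\beta+n\alpha+m+1}. \end{aligned} $$ When $\operatorname{Re}\beta>-1$ the sums are empty and this is the ordinary integral. *)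

(* Defs.v *)
From Stdlib Require Import Reals Lra Lia ZArith Arith.
From Coquelicot Require Export Coquelicot.

Open Scope R_scope.
Open Scope C_scope.

Definition Cexp (w : C) : C := ((exp (Re w) * cos (Im w))%R, (exp (Re w) * sin (Im w))%R).

(* t^b for t > 0 and complex b, with the principal (real) logarithm of t. *)
Definition Rcpow (t : R) (b : C) : C := Cexp (b * ln t).

Definition entire (F : C -> C) : Prop :=
  forall z : C, ex_derive (K := C_AbsRing) (V := C_NormedModule) F z.

(* All sums below run over the pairs (m, n) of naturals satisfying
   m + n a + Re b <= -1 or m + n a + b + 1 = 0.  For a > 1 either condition
   forces m, n < index_bound b (lemmas index_boundP and index_boundP0), so
   summing over the square 0 <= m, n <= index_bound b loses no term. *)
Definition index_bound (b : C) : nat := Z.to_nat (up (- Re b)).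

Definition sum_pairs (b : C) (f : nat -> nat -> C) : C :=
  sum_n (fun m : nat => sum_n (fun n : nat => f m n) (index_bound b)) (index_bound b).

(* Sum over m + n a + Re b <= -1. *)
Definition singular_sum (a : R) (b : C) (f : nat -> nat -> C) : C :=
  sum_pairs b (fun m n =>
    if Rle_dec (INR m + INR n * a + Re b)%R (-1)%R then f m n else 0).

(* Primed sum over m + n a + Re b <= -1: the terms with b + n a + m + 1 = 0
   are omitted. *)
Definition singular_sum' (a : R) (b : C) (f : nat -> nat -> C) : C :=
  singular_sum a b (fun m n =>
    if Ceq_dec (b + INR n * a + INR m + 1) 0 then 0 else f m n).

(* Sum over m + n a + b + 1 = 0. *)
Definition resonant_sum (a : R) (b : C) (f : nat -> nat -> C) : C :=
  sum_pairs b (fun m n =>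
    if Ceq_dec (INR m + INR n * a + b + 1) 0 then f m n else 0).

(* [is_finite_part a b g c v]: the expression
     int_1^oo t^b g(t) dt
     + int_0^1 t^b (g(t) - sum_{m + n a + Re b <= -1} c_{m,n} t^(n a + m)) dt
     + sum'_{m + n a + Re b <= -1} c_{m,n} / (b + n a + m + 1)
   is meaningful (both integrals converge) and equals v.  The integrals are
   improper Riemann integrals of C-valued functions, the second one being
   improper at 0. *)
Definition is_finite_part (a : R) (b : C) (g : R -> C) (c : nat -> nat -> C)
    (v : C) : Prop :=
  exists I_infty I_zero : C,
    is_RInt_gen (V := C_R_NormedModule)
      (fun t : R => Rcpow t b * g t)
      (at_point 1%R) (Rbar_locally p_infty) I_infty /\
    is_RInt_gen (V := C_R_NormedModule)
      (fun t : R => Rcpow t b *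
         (g t - singular_sum a b (fun m n => c m n * Rpower t (INR n * a + INR m)%R)))
      (at_right 0%R) (at_point 1%R) I_zero /\
    v = I_infty + I_zero
        + singular_sum' a b (fun m n => c m n * (1 / (b + INR n * a + INR m + 1))).

(* exp(i t^a - i z t) is the sum over m, n of osc_coef z m n * t^(n a + m). *)
Definition osc_coef (z : C) (m n : nat) : C :=
  Ci ^ n * (- Ci * z) ^ m / (INR (fact n) * INR (fact m)).

(* F_{a,b}(z) = v, where
   F_{a,b}(z) = F.p. int_0^oo t^b exp(i t^a - i z t) dt. *)
Definition is_osc_FP (a : R) (b z v : C) : Prop :=
  is_finite_part a b
    (fun t : R => Cexp (Ci * Rpower t a - Ci * z * t)) (osc_coef z) v.

(* exp(- t^a - i e^(i pi/(2a)) z t) is the sum over m, n of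
   rot_coef a z m n * t^(n a + m). *)
Definition rot_coef (a : R) (z : C) (m n : nat) : C :=
  (- (1)) ^ n * (- Ci * z) ^ m * Cexp (Ci * INR m * PI / (2 * a))
    / (INR (fact n) * INR (fact m)).

(* The finite part integral along the ray t = e^(i pi/(2a)) s, written in
   the variable s and without the factor e^(i (b+1) pi/(2a)) coming from
   t^b dt. *)
Definition is_rot_FP (a : R) (b z v : C) : Prop :=
  is_finite_part a b
    (fun t : R =>
       Cexp (- RtoC (Rpower t a) - Ci * Cexp (Ci * PI / (2 * a)) * z * t))
    (rot_coef a z) v.

Lemma index_boundP (a : R) (b : C) (m n : nat) :
  (1 < a)%R -> (INR m + INR n * a + Re b <= -1)%R ->
  (m < index_bound b)%nat /\ (n < index_bound b)%nat.
Proof.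
intros Ha H; unfold index_bound.
destruct (archimed (- Re b)%R) as [Hu _].
assert (Hm := pos_INR m); assert (Hn := pos_INR n).
assert (Hna : (INR n <= INR n * a)%R) by nra.
split.
- assert (K : (IZR (Z.of_nat m) < IZR (up (- Re b)%R))%R)
    by (rewrite <- INR_IZR_INZ; lra).
  apply lt_IZR in K; lia.
- assert (K : (IZR (Z.of_nat n) < IZR (up (- Re b)%R))%R)
    by (rewrite <- INR_IZR_INZ; lra).
  apply lt_IZR in K; lia.
Qed.

Lemma index_boundP0 (a : R) (b : C) (m n : nat) :
  (1 < a)%R -> INR m + INR n * a + b + 1 = 0 ->
  (m < index_bound b)%nat /\ (n < index_bound b)%nat.
Proof.
intros Ha H; apply (index_boundP a); [exact Ha|].
apply (f_equal Re) in H; cbn in H; unfold Re; lra.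
Qed.

(* Main.v *)
Require Import Defs.
From Stdlib Require Import Reals Lra Lia Arith ZArith.
From Coquelicot Require Import Coquelicot.
Open Scope R_scope.
Open Scope C_scope.

(** Near [t = 0] the integrand is [t^b exp (p t^a + q t)], with [p = i] and
    [q = - i z] on the half-line, and [p = -1] and [q = - i e^(i th) z] on the
    ray of angle [th = pi / (2 a)], because [i e^(i a th) = -1].  Subtract from
    the exponential a product of Taylor polynomials of [exp], one in [p t^a] and
    one in [q t], both of degree [N = index_bound b].  Since [N + Re b > 0], what
    is left is [O(t)] after multiplication by [t^b].  The subtracted terms
    [c t^(mu - 1)] with [Re mu > 0] integrate to [c / mu], so the finite part is
      [int_1^oo t^b f + int_0^1 t^b (f - trunc)
        + sum over the square of c / mu, terms with mu = 0 left out]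
    ([is_finite_part_intro]); the threshold [Re mu <= 0] has disappeared.

    On the ray the factor [exp (- t^a)] beats [exp (q t)] for every [q], so both
    integrals may be differentiated under the integral sign with respect to [q]
    ([hol_outer], [hol_inner]), and the remaining sums are polynomials in [z].
    Hence the right-hand side of the formula is an entire function.

    It remains to identify it with the integral along the half-line when
    [Im z < 0] ([rotation]).  In the coordinate [w = ln t] the integrand
    [t^b f dt] becomes [k w dw] with [k] entire, and turning the ray means
    shifting the line of integration by [i th].  Cauchy's theorem on rectangles
    ([log_rectangle]) gives the difference of the integrals over two rays in
    terms of integrals over arcs.  The arc at infinity contributes nothing, by
    [oscillatory_decay]: the growth that the rotation gives to [exp (- i z t)]
    is proportional to [sin ph], and is compensated by the decay of
    [exp (i t^a)].  The arc at [0] contributes nothing for [f - trunc].  The two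
    integrals over the unit arc cancel except for the one of [trunc], which is
    explicit: a term with [mu <> 0] gives [c (e^(i mu th) - 1) / mu], which is
    the change of the corresponding pole term, and a term with [mu = 0] gives
    [c i th], which is the resonant correction. *)

(** * Complex derivatives *)

Definition hol (f : C -> C) (z l : C) : Prop :=
  is_derive (K := C_AbsRing) (V := C_NormedModule) f z l.
Definition curve (g : R -> C) (t : R) (l : C) : Prop :=
  is_derive (K := R_AbsRing) (V := C_R_NormedModule) g t l.

Lemma norm_C_R (x : C) : norm (V := C_R_NormedModule) x = Cmod x.
Proof.
  destruct x as [x y]; unfold Cmod, norm; simpl; unfold prod_norm; simpl.
  unfold norm; simpl; unfold abs; simpl.
  f_equal. generalize (Rsqr_abs x) (Rsqr_abs y); unfold Rsqr; lra.
Qed.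

Lemma hol_eps f z l : hol f z l <->
  forall eps : R, (0 < eps)%R -> exists d : R, (0 < d)%R /\
    forall h : C, (Cmod h < d)%R -> (Cmod (f (z + h) - f z - l * h)%C <= eps * Cmod h)%R.
Proof.
  unfold hol, is_derive, filterdiff; split.
  - intros [_ H] eps He.
    assert (Hz : is_filter_lim (T := AbsRing_UniformSpace C_AbsRing) (locally (T := AbsRing_UniformSpace C_AbsRing) z) z) by (intros P HP; exact HP).
    destruct (H z Hz (mkposreal eps He)) as [d Hd].
    exists d; split; [apply cond_pos|]. intros h Hh.
    assert (K : minus (G := C_AbsRing) (z + h)%C z = h).
    { unfold minus, plus, opp; simpl. ring. }
    specialize (Hd (z + h)).
    unfold ball in Hd; simpl in Hd; unfold AbsRing_ball, abs in Hd; simpl in Hd.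
    unfold minus, plus, opp, scal, norm in Hd; simpl in Hd.
    unfold minus, plus, opp, scal, norm in K; simpl in K. unfold mult, abs in Hd; simpl in Hd.
    rewrite K in Hd. specialize (Hd Hh).
    replace (f (z + h) - f z - l * h) with (f (z + h) + - f z + - (h * l)) by ring.
    exact Hd.
  - intros H; split; [apply is_linear_scal_l|].
    intros x Hx eps.
    assert (Ex : x = z).
    { symmetry. apply (is_filter_lim_locally_unique (V := AbsRing_NormedModule C_AbsRing)); exact Hx. }
    subst x.
    destruct (H eps (cond_pos eps)) as [d [Hd Hh]].
    exists (mkposreal d Hd). intros y Hy.
    unfold ball in Hy; simpl in Hy; unfold AbsRing_ball, abs, minus, plus, opp in Hy; simpl in Hy.
    specialize (Hh _ Hy).
    unfold minus, plus, opp, scal, norm; simpl. unfold mult, abs; simpl.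
    assert (E : forall w : C, z + (w + - z) = w) by (intros; ring).
    rewrite (E y) in Hh.
    assert (E2 : forall w u v : C, w + - u + - (v * l) = w - u - l * v) by (intros; ring).
    rewrite E2. exact Hh.
Qed.

Lemma curve_eps g t l : curve g t l <->
  forall eps : R, (0 < eps)%R -> exists d : R, (0 < d)%R /\
    forall s : R, (Rabs s < d)%R -> (Cmod (g (t + s)%R - g t - l * s)%C <= eps * Rabs s)%R.
Proof.
  unfold curve, is_derive, filterdiff; split.
  - intros [_ H] eps He.
    assert (Hz : is_filter_lim (T := R_UniformSpace) (locally t) t) by (intros P HP; exact HP).
    destruct (H t Hz (mkposreal eps He)) as [d Hd].
    exists d; split; [apply cond_pos|]. intros s Hs.
    specialize (Hd (t + s)%R).
    assert (K : ((t + s) - t = s)%R) by ring.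
    assert (B : ball t d (t + s)%R).
    { unfold ball; simpl. unfold AbsRing_ball, abs, minus, plus, opp; simpl.
      replace (t + s + - t)%R with s by ring. exact Hs. }
    specialize (Hd B).
    assert (Hd' : (Cmod (g (t + s)%R - g t - RtoC ((t + s) - t)%R * l)%C
                    <= eps * Rabs ((t + s) - t))%R).
    { rewrite <- norm_C_R, <- scal_R_Cmult. exact Hd. }
    rewrite K in Hd'.
    replace (g (t + s)%R - g t - l * s) with (g (t + s)%R - g t - s * l) by ring.
    exact Hd'.
  - intros H; split; [apply is_linear_scal_l|].
    intros x Hx eps.
    assert (Ex : x = t).
    { symmetry. apply (is_filter_lim_locally_unique (V := R_NormedModule)); exact Hx. }
    subst x.
    destruct (H eps (cond_pos eps)) as [d [Hd Hh]].
    exists (mkposreal d Hd). intros y Hy.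
    specialize (Hh _ Hy). rewrite norm_C_R, scal_R_Cmult.
    unfold minus, plus, opp in *; simpl in *.
    replace (t + (y + - t))%R with y in Hh by ring.
    change (Cmod (g y + - g t + - (RtoC (y + - t)%R * l))%C <= eps * Rabs (y + - t))%R.
    replace (g y + - g t + - (RtoC (y + - t)%R * l)) with (g y - g t - l * RtoC (y + - t)%R) by ring.
    exact Hh.
Qed.

Lemma Cmod_fst (x : C) : (Rabs (fst x) <= Cmod x)%R.
Proof. eapply Rle_trans; [|apply Rmax_Cmod]. apply Rmax_l. Qed.
Lemma curve_pair (g1 g2 : R -> R) t l1 l2 :
  is_derive g1 t l1 -> is_derive g2 t l2 -> curve (fun s => (g1 s, g2 s)) t (l1, l2).
Proof.
  intros H1 H2.
  assert (Hid : filterdiff (K := R_AbsRing)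
      (U := prod_NormedModule R_AbsRing R_NormedModule R_NormedModule)
      (V := C_R_NormedModule) (fun p => (fst p, snd p))
      (locally (g1 t, g2 t)) (fun p => (fst p, snd p))).
  { apply (filterdiff_ext_lin _ (fun x => x)); [|now intros []].
    apply (filterdiff_ext (fun x => x)); [now intros []|].
    apply filterdiff_id. }
  exact (filterdiff_comp'_2 g1 g2 (fun a b => (a, b)) t _ _ (fun a b => (a, b)) H1 H2 Hid).
Qed.

Lemma curve_Re_mul (c : C) (g : R -> C) t l :
  curve g t l -> is_derive (fun s => Re (c * g s)) t (Re (c * l)).
Proof.
  intros H. apply is_derive_Reals. intros eps He.
  assert (Hc := Cmod_ge_0 c).
  destruct (proj1 (curve_eps g t l) H (eps / (2 * (Cmod c + 1)))%R) as [d [Hd Hh]].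
  { apply Rdiv_lt_0_compat; lra. }
  exists (mkposreal d Hd). intros h Hh0 Hhd. specialize (Hh h Hhd).
  assert (Hp := Rabs_pos_lt h Hh0).
  replace ((Re (c * g (t + h)%R) - Re (c * g t)) / h - Re (c * l))%R
    with (Re (c * (g (t + h)%R - g t - l * h)) / h)%R.
  2: { destruct c, (g (t + h)%R), (g t), l; simpl; field; exact Hh0. }
  rewrite Rabs_div by exact Hh0.
  apply Rle_lt_trans with (Cmod (c * (g (t + h)%R - g t - l * h)) / Rabs h)%R.
  { apply Rmult_le_compat_r; [left; apply Rinv_0_lt_compat, Hp|]. apply Cmod_fst. }
  rewrite Cmod_mult.
  apply Rlt_div_l; [exact Hp|].
  apply Rle_lt_trans with (Cmod c * (eps / (2 * (Cmod c + 1)) * Rabs h))%R.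
  { apply Rmult_le_compat_l; assumption. }
  replace (Cmod c * (eps / (2 * (Cmod c + 1)) * Rabs h))%R
    with (Cmod c / (Cmod c + 1) * (/ 2) * (eps * Rabs h))%R by (field; lra).
  assert (Cmod c / (Cmod c + 1) <= 1)%R by (apply Rle_div_l; lra).
  assert (0 < eps * Rabs h)%R by (apply Rmult_lt_0_compat; assumption).
  nra.
Qed.

(** A norm bound on the derivative bounds the increment: the real mean value
    theorem applies to the component of [g] in the direction of the increment. *)
Lemma mean_value (g g' : R -> C) (M : R) :
  (forall u, (0 <= u <= 1)%R -> curve g u (g' u) /\ (Cmod (g' u) <= M)%R) ->
  (Cmod (g 1%R - g 0%R)%C <= M)%R.
Proof.
  (* Multiplication by c makes the increment of g real: c (g 1 - g 0) = |g 1 - g 0|^2. *)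
  intros H. set (c := Cconj (g 1%R - g 0%R)).
  destruct (MVT_gen (fun u => Re (c * g u)) 0 1 (fun u => Re (c * g' u))) as [x [Hx E]].
  - intros x Hx. rewrite Rmin_left, Rmax_right in Hx by lra.
    apply curve_Re_mul. apply H; lra.
  - intros x Hx. rewrite Rmin_left, Rmax_right in Hx by lra.
    apply derivable_continuous_pt. eexists. apply is_derive_Reals. apply curve_Re_mul.
    apply H; lra.
  - rewrite Rmin_left, Rmax_right in Hx by lra. destruct (H x Hx) as [_ HM].
    assert (E1 : (Cmod (g 1%R - g 0%R)%C * Cmod (g 1%R - g 0%R)%C = Re (c * g' x))%R).
    { rewrite Rminus_0_r, Rmult_1_r in E. rewrite <- E.
      transitivity (Re (c * (g 1%R - g 0%R))).
      - unfold c. rewrite Cmult_comm, <- Cmod2_conj.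
        rewrite re_RtoC. ring.
      - destruct c, (g 1%R), (g 0%R); simpl; ring. }
    assert (E2 : (Re (c * g' x) <= Cmod c * Cmod (g' x))%R).
    { rewrite <- Cmod_mult. eapply Rle_trans; [apply Rle_abs|]. apply Cmod_fst. }
    assert (Ec : Cmod c = Cmod (g 1%R - g 0%R)%C) by apply Cmod_conj.
    rewrite Ec in E2. assert (P := Cmod_ge_0 (g 1%R - g 0%R)%C).
    assert (P2 := Cmod_ge_0 (g' x)).
    destruct (Rle_lt_or_eq_dec _ _ P) as [P'|P']; [|rewrite <- P'; lra].
    apply (Rmult_le_reg_l _ _ _ P'). nra.
Qed.

(** Chain rule for a real curve followed by a complex function. *)
Lemma hol_curve f g t l m : hol f (g t) l -> curve g t m -> curve (fun s => f (g s)) t (l * m).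
Proof.
  intros Hf Hg. apply curve_eps. intros eps He.
  assert (Pl := Cmod_ge_0 l). assert (Pm := Cmod_ge_0 m).
  set (e1 := (eps / (2 * (Cmod m + 1)))%R).
  assert (He1 : (0 < e1)%R) by (apply Rdiv_lt_0_compat; lra).
  set (e2 := Rmin 1 (eps / (2 * (Cmod l + 1)))%R).
  assert (He2 : (0 < e2)%R).
  { apply Rmin_pos; [lra|]. apply Rdiv_lt_0_compat; lra. }
  destruct (proj1 (hol_eps _ _ _) Hf _ He1) as [d1 [Hd1 H1]].
  destruct (proj1 (curve_eps _ _ _) Hg _ He2) as [d2 [Hd2 H2]].
  exists (Rmin d2 (d1 / (Cmod m + 2)))%R. split.
  { apply Rmin_pos; [lra|]. apply Rdiv_lt_0_compat; lra. }
  intros s Hs.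
  assert (Hs2 : (Rabs s < d2)%R) by (eapply Rlt_le_trans; [exact Hs|apply Rmin_l]).
  assert (Hs1 : (Rabs s < d1 / (Cmod m + 2))%R) by (eapply Rlt_le_trans; [exact Hs|apply Rmin_r]).
  specialize (H2 s Hs2). apply Rlt_div_r in Hs1; [|lra].
  set (h := g (t + s)%R - g t) in *.
  assert (Pa := Rabs_pos s).
  assert (e2le : (e2 <= 1)%R) by apply Rmin_l.
  assert (Bh : (Cmod h <= (Cmod m + 1) * Rabs s)%R).
  { replace h with ((h - m * s) + m * s) by ring.
    eapply Rle_trans; [apply Cmod_triangle|]. rewrite Cmod_mult, Cmod_R. nra. }
  assert (Bh1 : (Cmod h < d1)%R) by nra.
  specialize (H1 h Bh1).
  replace (g t + h) with (g (t + s)%R) in H1 by (unfold h; ring).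
  replace (f (g (t + s)%R) - f (g t) - l * m * s)
    with ((f (g (t + s)%R) - f (g t) - l * h) + l * (h - m * s)) by ring.
  eapply Rle_trans; [apply Cmod_triangle|]. rewrite Cmod_mult.
  assert (X1 : (e1 * Cmod h <= eps / 2 * Rabs s)%R).
  { apply Rle_trans with (e1 * ((Cmod m + 1) * Rabs s))%R; [apply Rmult_le_compat_l; lra|].
    unfold e1. right. field. lra. }
  assert (X2 : (Cmod l * (e2 * Rabs s) <= eps / 2 * Rabs s)%R).
  { rewrite <- Rmult_assoc. apply Rmult_le_compat_r; [exact Pa|].
    apply Rle_trans with (Cmod l * (eps / (2 * (Cmod l + 1))))%R.
    { apply Rmult_le_compat_l; [lra|apply Rmin_r]. }
    replace (Cmod l * (eps / (2 * (Cmod l + 1))))%R with (Cmod l / (Cmod l + 1) * (eps / 2))%R by (field; lra).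
    assert (Cmod l / (Cmod l + 1) <= 1)%R by (apply Rle_div_l; lra). nra. }
  assert (X3 := Rmult_le_compat_l _ _ _ Pl H2). lra.
Qed.

Lemma curve_line (x h : C) u : curve (fun s => x + s * h) u h.
Proof.
  apply curve_eps. intros eps He. exists 1%R. split; [lra|]. intros s _.
  replace (x + (u + s)%R * h - (x + u * h) - h * s) with (RtoC 0).
  2: rewrite RtoC_plus; ring.
  rewrite Cmod_0. apply Rmult_le_pos; [lra|apply Rabs_pos].
Qed.

Lemma hol_const (c z : C) : hol (fun _ => c) z 0.
Proof. apply (is_derive_const (K := C_AbsRing) (V := C_NormedModule)). Qed.
(** [C] is a normed module over itself in two ways, with the same norm but with
    different balls; derivatives only see the norm. *)
Lemma hol_AbsRing f z l :
  is_derive (K := C_AbsRing) (V := AbsRing_NormedModule C_AbsRing) f z l -> hol f z l.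
Proof.
  intros [_ H]. split; [apply is_linear_scal_l|exact H].
Qed.
Lemma hol_id (z : C) : hol (fun w => w) z 1.
Proof. exact (hol_AbsRing _ _ _ (is_derive_id (K := C_AbsRing) z)). Qed.
Lemma hol_plus f g z l m : hol f z l -> hol g z m -> hol (fun w => f w + g w) z (l + m).
Proof. apply (is_derive_plus (K := C_AbsRing) (V := C_NormedModule)). Qed.
Lemma hol_mult f g z l m : hol f z l -> hol g z m ->
  hol (fun w => f w * g w) z (l * g z + f z * m).
Proof.
  intros [_ Hf] [_ Hg]. apply hol_AbsRing.
  apply (is_derive_mult (K := C_AbsRing) f g z l m); [| |apply Cmult_comm];
    (split; [apply is_linear_scal_l|assumption]).
Qed.
Lemma hol_comp f g z l m : hol f (g z) l -> hol g z m -> hol (fun w => f (g w)) z (m * l).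
Proof.
  intros Hf [_ Hg]. apply (is_derive_comp (K := C_AbsRing) (V := C_NormedModule) f g z l m Hf).
  split; [apply is_linear_scal_l|exact Hg].
Qed.
Lemma hol_val f z l m : hol f z l -> l = m -> hol f z m.
Proof. now intros H <-. Qed.
Lemma hol_ext f g z l : (forall w, f w = g w) -> hol f z l -> hol g z l.
Proof. intros E. apply (is_derive_ext (K := C_AbsRing) (V := C_NormedModule) f g z l E). Qed.

(** * The exponential and its Taylor remainders *)

Lemma Cexp_plus (x y : C) : Cexp (x + y) = Cexp x * Cexp y.
Proof.
  destruct x as [x1 x2], y as [y1 y2]; unfold Cexp, Cmult; simpl.
  rewrite exp_plus, cos_plus, sin_plus. f_equal; ring.
Qed.

Lemma Cexp_0 : Cexp 0 = 1.
Proof. unfold Cexp; simpl. rewrite exp_0, cos_0, sin_0. unfold RtoC; f_equal; ring. Qed.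

Lemma Cmod_Cexp (x : C) : Cmod (Cexp x) = exp (Re x).
Proof.
  unfold Cmod, Cexp; simpl.
  replace (exp (Re x) * cos (Im x) * (exp (Re x) * cos (Im x) * 1) +
           exp (Re x) * sin (Im x) * (exp (Re x) * sin (Im x) * 1))%R
    with (Rsqr (exp (Re x)) * (Rsqr (sin (Im x)) + Rsqr (cos (Im x))))%R by (unfold Rsqr; ring).
  rewrite sin2_cos2, Rmult_1_r. apply sqrt_Rsqr. left; apply exp_pos.
Qed.

Lemma Cmod_Cexp_le (x : C) : (Cmod (Cexp x) <= exp (Cmod x))%R.
Proof.
  rewrite Cmod_Cexp.
  assert (Re x <= Cmod x)%R by (eapply Rle_trans; [apply Rle_abs|apply Cmod_fst]).
  destruct (Rle_lt_or_eq_dec _ _ H) as [L|<-]; [left; now apply exp_increasing|lra].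
Qed.

Lemma exp_le (x y : R) : (x <= y)%R -> (exp x <= exp y)%R.
Proof. intros [L| <-]; [left; now apply exp_increasing|lra]. Qed.

Lemma Cexp_INR_mul (n : nat) (x : C) : Cexp (INR n * x) = Cexp x ^ n.
Proof.
  induction n as [|n IH].
  - simpl. rewrite Cmult_0_l. apply Cexp_0.
  - rewrite S_INR, RtoC_plus. replace ((INR n + 1) * x) with (x + INR n * x) by ring.
    rewrite Cexp_plus, IH. reflexivity.
Qed.

Lemma Cexp_RtoC (x : R) : Cexp x = exp x.
Proof. unfold Cexp; simpl. rewrite cos_0, sin_0. unfold RtoC; f_equal; ring. Qed.

Lemma curve_Cexp_line (h : C) (u : R) : curve (fun s => Cexp (s * h)) u (h * Cexp (u * h)).
Proof.
  destruct h as [h1 h2]. unfold Cexp; simpl.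
  match goal with |- curve _ _ ?l => rewrite (surjective_pairing l) end.
  apply curve_pair; simpl; auto_derive; auto; unfold Rminus; ring.
Qed.

Lemma Cmod_segment_le (u : R) (h : C) :
  (0 <= u <= 1)%R -> (Cmod (u * h) <= Cmod h)%R.
Proof.
  intros Hu. rewrite Cmod_mult, Cmod_R, Rabs_pos_eq by lra.
  assert (P := Cmod_ge_0 h). nra.
Qed.

Lemma Cexp_sub_1 (h : C) : (Cmod (Cexp h - 1)%C <= Cmod h * exp (Cmod h))%R.
Proof.
  assert (H := mean_value (fun s => Cexp (s * h)) (fun u => h * Cexp (u * h))
                (Cmod h * exp (Cmod h))).
  simpl in H. rewrite Cmult_1_l, Cmult_0_l, Cexp_0 in H. apply H.
  intros u Hu. split; [apply curve_Cexp_line|].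
  rewrite Cmod_mult. apply Rmult_le_compat_l; [apply Cmod_ge_0|].
  eapply Rle_trans; [apply Cmod_Cexp_le|]. apply exp_le. now apply Cmod_segment_le.
Qed.

Lemma curve_minus (f g : R -> C) t l m :
  curve f t l -> curve g t m -> curve (fun s => f s - g s) t (l - m).
Proof. apply (is_derive_minus (K := R_AbsRing) (V := C_R_NormedModule)). Qed.

Lemma curve_ext (f g : R -> C) t l : (forall s, f s = g s) -> curve f t l -> curve g t l.
Proof. intros E. apply (is_derive_ext (K := R_AbsRing) (V := C_R_NormedModule) f g t l E). Qed.

Lemma curve_scal_line (c : C) u : curve (fun s => s * c) u c.
Proof. apply (curve_ext (fun s => 0 + s * c)); [intros; ring|apply curve_line]. Qed.

Lemma Cexp_taylor1 (h : C) :
  (Cmod (Cexp h - 1 - h)%C <= Cmod h * Cmod h * exp (Cmod h))%R.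
Proof.
  assert (H := mean_value (fun s => Cexp (s * h) - s * h) (fun u => h * Cexp (u * h) - h)
                (Cmod h * (Cmod h * exp (Cmod h)))).
  simpl in H. rewrite Cmult_1_l, Cmult_0_l, Cexp_0 in H.
  replace (Cexp h - 1 - h) with (Cexp h - h - (1 - 0)) by ring.
  rewrite Rmult_assoc. apply H.
  intros u Hu. split; [apply curve_minus; [apply curve_Cexp_line|apply curve_scal_line]|].
  replace (h * Cexp (u * h) - h) with (h * (Cexp (u * h) - 1)) by ring.
  rewrite Cmod_mult. apply Rmult_le_compat_l; [apply Cmod_ge_0|].
  eapply Rle_trans; [apply Cexp_sub_1|].
  assert (L := Cmod_segment_le u h Hu).
  apply Rmult_le_compat; [apply Cmod_ge_0|left; apply exp_pos|exact L|now apply exp_le].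
Qed.

(** Quadratic error bounds, unlike limits, can be integrated; the derivatives of the
    exponential and of the integrals are obtained in this way. *)
Lemma hol_of_quadratic f (z l : C) (M r : R) :
  (0 < r)%R ->
  (forall h, (Cmod h <= r)%R -> (Cmod (f (z + h) - f z - l * h)%C <= M * (Cmod h * Cmod h))%R) ->
  hol f z l.
Proof.
  intros Hr H. apply hol_eps. intros eps He.
  assert (Pm := Rabs_pos M).
  exists (Rmin r (eps / (Rabs M + 1)))%R. split.
  { apply Rmin_pos; [exact Hr|]. apply Rdiv_lt_0_compat; lra. }
  intros h Hh.
  assert (H1 : (Cmod h <= r)%R) by (left; eapply Rlt_le_trans; [exact Hh|apply Rmin_l]).
  assert (H2 : (Cmod h < eps / (Rabs M + 1))%R) by (eapply Rlt_le_trans; [exact Hh|apply Rmin_r]).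
  apply Rlt_div_r in H2; [|lra].
  eapply Rle_trans; [apply (H h H1)|].
  assert (Ph := Cmod_ge_0 h). assert (M <= Rabs M)%R by apply Rle_abs.
  assert (M * Cmod h <= eps)%R by nra. nra.
Qed.

Lemma hol_Cexp (z : C) : hol Cexp z (Cexp z).
Proof.
  apply (hol_of_quadratic _ _ _ (Cmod (Cexp z) * exp 1) 1); [lra|]. intros h Hh.
  rewrite Cexp_plus. replace (Cexp z * Cexp h - Cexp z - Cexp z * h)
    with (Cexp z * (Cexp h - 1 - h)) by ring.
  rewrite Cmod_mult, Rmult_assoc. apply Rmult_le_compat_l; [apply Cmod_ge_0|].
  eapply Rle_trans; [apply Cexp_taylor1|].
  rewrite Rmult_comm. apply Rmult_le_compat_r; [|now apply exp_le].
  apply Rmult_le_pos; apply Cmod_ge_0.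
Qed.

Lemma hol_increment f f1 (z h : C) (M : R) :
  (forall u, (0 <= u <= 1)%R ->
     hol f (z + u * h) (f1 (z + u * h)) /\ (Cmod (f1 (z + u * h)%C) <= M)%R) ->
  (Cmod (f (z + h) - f z)%C <= M * Cmod h)%R.
Proof.
  intros H.
  assert (K := mean_value (fun s => f (z + s * h)) (fun u => f1 (z + u * h) * h) (M * Cmod h)).
  simpl in K. rewrite Cmult_1_l, Cmult_0_l, Cplus_0_r in K. apply K.
  intros u Hu. destruct (H u Hu) as [H1 H2]. split.
  - apply (hol_curve f (fun s => z + s * h)); [exact H1|apply curve_line].
  - rewrite Cmod_mult. apply Rmult_le_compat_r; [apply Cmod_ge_0|exact H2].
Qed.

(** Two applications of [hol_increment] along the segment from [z] to [z + h]. *)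
Lemma hol_taylor1 f f1 f2 (z h : C) (M : R) :
  (forall u, (0 <= u <= 1)%R ->
     hol f (z + u * h) (f1 (z + u * h)) /\ hol f1 (z + u * h) (f2 (z + u * h)) /\
     (Cmod (f2 (z + u * h)%C) <= M)%R) ->
  (Cmod (f (z + h) - f z - f1 z * h)%C <= M * (Cmod h * Cmod h))%R.
Proof.
  intros H.
  assert (K := hol_increment (fun w => f w + - f1 z * w) (fun w => f1 w + - f1 z) z h (M * Cmod h)).
  simpl in K.
  replace (f (z + h) - f z - f1 z * h)
    with (f (z + h) + - f1 z * (z + h) - (f z + - f1 z * z)) by ring.
  rewrite <- Rmult_assoc. apply K. intros u Hu. split.
  - apply hol_plus; [apply (H u Hu)|].
    eapply hol_val; [apply (hol_mult (fun _ => - f1 z) (fun w => w) _ _ _ (hol_const _ _) (hol_id _))|ring].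
  - assert (K2 := hol_increment f1 f2 z (u * h) M).
    replace (f1 (z + u * h) + - f1 z) with (f1 (z + u * h) - f1 z) by ring.
    eapply Rle_trans; [apply K2|].
    + intros v Hv. assert (Huv : (0 <= v * u <= 1)%R) by nra.
      replace (z + v * (u * h)) with (z + (v * u)%R * h) by (rewrite RtoC_mult; ring).
      destruct (H _ Huv) as [_ [A B]]. now split.
    + apply Rmult_le_compat_l; [|now apply Cmod_segment_le].
      destruct (H u Hu) as [_ [_ B]]. eapply Rle_trans; [apply Cmod_ge_0|exact B].
Qed.

Lemma hol_pow (n : nat) (z : C) : hol (fun w => w ^ n) z (INR n * z ^ pred n).
Proof.
  induction n as [|n IH].
  - eapply hol_val; [exact (hol_const 1 z)|]. simpl. ring.
  - eapply hol_val; [apply (hol_mult (fun w => w) (fun w => w ^ n) _ _ _ (hol_id z) IH)|].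
    rewrite S_INR, RtoC_plus. destruct n; simpl; ring.
Qed.

Lemma INR_fact_neq_0_C n : RtoC (INR (fact n)) <> 0.
Proof. intros E. apply (INR_fact_neq_0 n). now apply RtoC_inj. Qed.

(** The first [k] terms of the exponential series; in this indexing the derivative
    of [expsum k] is [expsum (pred k)] for every [k], [k = 0] included. *)
Fixpoint expsum (k : nat) (x : C) : C :=
  match k with O => 0 | S j => expsum j x + x ^ j / INR (fact j) end.

Lemma expsum_0 k : expsum (S k) 0 = 1.
Proof.
  induction k as [|k IH]; [simpl; field; apply C1_nz|].
  change (expsum (S (S k)) 0) with (expsum (S k) 0 + 0 ^ S k / INR (fact (S k))).
  rewrite IH. simpl (0 ^ S k). unfold Cdiv. ring.
Qed.

Lemma hol_expsum k (z : C) : hol (expsum k) z (expsum (pred k) z).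
Proof.
  induction k as [|k IH]; [exact (hol_const 0 z)|].
  eapply hol_val.
  - refine (hol_plus (expsum k) (fun w => w ^ k / INR (fact k)) _ _ _ IH
      (hol_mult (fun w => w ^ k) (fun _ => / INR (fact k)) _ _ _ (hol_pow k z) (hol_const _ z))).
  - simpl pred. destruct k as [|k]; [simpl; ring|].
    simpl pred. change (expsum (S k) z) with (expsum k z + z ^ k / INR (fact k)).
    f_equal. rewrite fact_simpl, mult_INR, RtoC_mult.
    assert (RtoC (INR (S k)) <> 0) by (intros E; apply RtoC_inj in E; now apply (not_0_INR (S k))).
    field. split; [apply INR_fact_neq_0_C|exact H].
Qed.

(** Induction on [k]: the remainder of order [k + 1] vanishes at 0 and has the
    remainder of order [k] as derivative. *)
Lemma Cexp_remainder k (x : C) :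
  (Cmod (Cexp x - expsum k x)%C <= Cmod x ^ k * exp (Cmod x))%R.
Proof.
  revert x. induction k as [|k IH]; intros x.
  - simpl. replace (Cexp x - 0) with (Cexp x) by ring. rewrite Rmult_1_l. apply Cmod_Cexp_le.
  - assert (K := hol_increment (fun w => Cexp w + - (1) * expsum (S k) w)
                  (fun w => Cexp w + - (1) * expsum k w) 0 x (Cmod x ^ k * exp (Cmod x))).
    simpl in K. 
    change (expsum k 0 + 0 ^ k / INR (fact k)) with (expsum (S k) 0) in K.
    rewrite expsum_0, Cexp_0, Cplus_0_l in K.
    replace (Cexp x - expsum (S k) x)
      with (Cexp x + - (1) * (expsum k x + x ^ k / INR (fact k)) - (1 + - (1) * 1)) by (simpl; ring).
    simpl pow. rewrite Rmult_assoc, (Rmult_comm (Cmod x)). apply K.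
    intros u Hu. rewrite Cplus_0_l. split.
    + apply hol_plus; [apply hol_Cexp|].
      eapply hol_val; [apply (hol_mult (fun _ => - (1)) (expsum (S k)) _ _ _ (hol_const _ _) (hol_expsum (S k) _))|].
      simpl pred. ring.
    + replace (Cexp (u * x) + - (1) * expsum k (u * x)) with (Cexp (u * x) - expsum k (u * x)) by ring.
      eapply Rle_trans; [apply IH|].
      assert (L := Cmod_segment_le u x Hu). assert (P := Cmod_ge_0 (u * x)%C).
      apply Rmult_le_compat; [now apply pow_le|left; apply exp_pos|now apply pow_incr|now apply exp_le].
Qed.

(** * Improper integrals of complex functions *)

Notation CRInt := (is_RInt (V := C_R_NormedModule)).
Notation CI := (is_RInt_gen (V := C_R_NormedModule)).
Notation Ccontinuous := (continuous (T := R_UniformSpace) (U := C_UniformSpace)).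

(** [C_R_NormedModule] together with its completeness, which gives total integrals. *)
Definition C_R_CompleteNormedModule : CompleteNormedModule R_AbsRing :=
  CompleteNormedModule.Pack R_AbsRing C
    (CompleteNormedModule.Class R_AbsRing C (NormedModule.class R_AbsRing C_R_NormedModule)
       C_CompleteSpace_mixin) C.

Lemma CI_eps {Fa Fb : (R -> Prop) -> Prop} {FFa : Filter Fa} {FFb : Filter Fb} (f : R -> C) (l : C) :
  CI f Fa Fb l <->
  forall eps : R, (0 < eps)%R ->
    filter_prod Fa Fb (fun ab => exists y : C,
      CRInt f (fst ab) (snd ab) y /\ (Cmod (y - l)%C < eps)%R).
Proof.
  unfold is_RInt_gen, filterlimi, filter_le, filtermapi; split.
  - intros H eps He. apply (H (fun y : C => (Cmod (y - l)%C < eps)%R)).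
    apply (locally_le_locally_norm (V := C_R_NormedModule)).
    exists (mkposreal eps He). intros y Hy. unfold ball_norm in Hy. rewrite norm_C_R in Hy. exact Hy.
  - intros H P HP.
    apply (locally_norm_le_locally (V := C_R_NormedModule)) in HP. destruct HP as [eps HP].
    generalize (H eps (cond_pos eps)). apply filter_imp. intros ab [y [Hy E]].
    exists y. split; [exact Hy|]. apply HP. unfold ball_norm. rewrite norm_C_R. exact E.
Qed.

Lemma CRInt_Cmult (c : C) (f : R -> C) (a b : R) (l : C) :
  CRInt f a b l -> CRInt (fun t => c * f t) a b (c * l).
Proof.
  intros H. destruct c as [c1 c2].
  assert (H1 := is_RInt_fct_extend_fst f a b l H).
  assert (H2 := is_RInt_fct_extend_snd f a b l H).
  apply (is_RInt_fct_extend_pair (fun t => (c1, c2) * f t)); simpl.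
  - apply (is_RInt_minus (V := R_NormedModule) (fun t => c1 * fst (f t))%R (fun t => c2 * snd (f t))%R);
      apply (is_RInt_scal (V := R_NormedModule)); assumption.
  - apply (is_RInt_plus (V := R_NormedModule) (fun t => c1 * snd (f t))%R (fun t => c2 * fst (f t))%R);
      apply (is_RInt_scal (V := R_NormedModule)); assumption.
Qed.

Lemma CI_Cmult {Fa Fb : (R -> Prop) -> Prop} {FFa : Filter Fa} {FFb : Filter Fb}
  (c : C) (f : R -> C) (l : C) : CI f Fa Fb l -> CI (fun t => c * f t) Fa Fb (c * l).
Proof.
  intros H. apply CI_eps. intros eps He. assert (P := Cmod_ge_0 c).
  assert (He' : (0 < eps / (Cmod c + 1))%R) by (apply Rdiv_lt_0_compat; lra).
  generalize (proj1 (CI_eps f l) H _ He'). apply filter_imp.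
  intros ab [y [Hy E]]. exists (c * y). split; [now apply CRInt_Cmult|].
  replace (c * y - c * l) with (c * (y - l)) by ring. rewrite Cmod_mult.
  apply Rlt_div_r in E; [|lra]. assert (P2 := Cmod_ge_0 (y - l)%C). nra.
Qed.

Lemma CI_plus {Fa Fb : (R -> Prop) -> Prop} {FFa : Filter Fa} {FFb : Filter Fb} (f g : R -> C) (l m : C) :
  CI f Fa Fb l -> CI g Fa Fb m -> CI (fun t => f t + g t) Fa Fb (l + m).
Proof. apply (is_RInt_gen_plus (V := C_R_NormedModule)). Qed.

Lemma CI_minus {Fa Fb : (R -> Prop) -> Prop} {FFa : Filter Fa} {FFb : Filter Fb} (f g : R -> C) (l m : C) :
  CI f Fa Fb l -> CI g Fa Fb m -> CI (fun t => f t - g t) Fa Fb (l - m).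
Proof. apply (is_RInt_gen_minus (V := C_R_NormedModule)). Qed.

Lemma CRInt_unique (f : R -> C) a b l m : CRInt f a b l -> CRInt f a b m -> l = m.
Proof.
  intros H1 H2.
  apply (is_RInt_unique (V := C_R_CompleteNormedModule)) in H1, H2.
  congruence.
Qed.

Lemma curve_continuous (f : R -> C) t l : curve f t l -> Ccontinuous f t.
Proof. intros H. apply (ex_derive_continuous (K := R_AbsRing) (V := C_R_NormedModule)). now exists l. Qed.

Lemma ex_CRInt (f : R -> C) (a b : R) :
  (forall t, (Rmin a b <= t <= Rmax a b)%R -> Ccontinuous f t) -> exists l, CRInt f a b l.
Proof.
  apply (ex_RInt_continuous (V := C_R_CompleteNormedModule)).
Qed.

Lemma CRInt_bound (f : R -> C) (g : R -> R) (a b : R) (l : C) (m : R) :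
  (a <= b)%R -> (forall t, (a <= t <= b)%R -> (Cmod (f t) <= g t)%R) ->
  CRInt f a b l -> is_RInt g a b m -> (Cmod l <= m)%R.
Proof.
  intros Hab H Hf Hg. rewrite <- norm_C_R.
  apply (norm_RInt_le (V := C_R_NormedModule) f g a b); try assumption.
  intros t Ht. rewrite norm_C_R. now apply H.
Qed.

Lemma CI_bound {Fa Fb : (R -> Prop) -> Prop} {FFa : ProperFilter Fa} {FFb : ProperFilter Fb}
  (f : R -> C) (g : R -> R) (l : C) (m : R) :
  filter_prod Fa Fb (fun ab => (fst ab <= snd ab)%R /\
    forall t, (fst ab <= t <= snd ab)%R -> (Cmod (f t) <= g t)%R) ->
  CI f Fa Fb l -> is_RInt_gen g Fa Fb m -> (Cmod l <= m)%R.
Proof.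
  intros H Hf Hg. rewrite <- norm_C_R.
  apply (RInt_gen_norm (V := C_R_CompleteNormedModule) (Fa := Fa) (Fb := Fb) f g); try assumption.
  - generalize H. apply filter_imp. now intros ab [? _].
  - generalize H. apply filter_imp. intros ab [_ K] t Ht. rewrite norm_C_R. now apply K.
Qed.

Lemma CRInt_FTC (f f' : R -> C) (a b : R) :
  (forall t, (Rmin a b <= t <= Rmax a b)%R -> curve f t (f' t) /\ Ccontinuous f' t) ->
  CRInt f' a b (f b - f a).
Proof.
  intros H. apply (is_RInt_derive (V := C_R_CompleteNormedModule) f f'); intros t Ht; now apply H.
Qed.

(** Differentiation under the integral sign, from a quadratic error bound with an
    integrable coefficient. *)
Lemma hol_integral {Fa Fb : (R -> Prop) -> Prop} {FFa : ProperFilter Fa} {FFb : ProperFilter Fb}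
  (K0 : C -> R -> C) (K1 : R -> C) (I0 : C -> C) (I1 z : C) (M : R -> R) (m r : R) :
  (0 < r)%R ->
  (forall q, CI (K0 q) Fa Fb (I0 q)) -> CI K1 Fa Fb I1 -> is_RInt_gen M Fa Fb m ->
  filter_prod Fa Fb (fun ab => (fst ab <= snd ab)%R /\
    forall t, (fst ab <= t <= snd ab)%R -> forall h, (Cmod h <= r)%R ->
      (Cmod (K0 (z + h)%C t - K0 z t - K1 t * h)%C <= M t * (Cmod h * Cmod h))%R) ->
  hol I0 z I1.
Proof.
  intros Hr H0 H1 HM H. apply (hol_of_quadratic _ _ _ m r Hr). intros h Hh.
  apply (CI_bound (Fa := Fa) (Fb := Fb) (fun t => K0 (z + h) t - K0 z t - h * K1 t)
           (fun t => (Cmod h * Cmod h) * M t)%R).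
  - generalize H. apply filter_imp. intros ab [Hab K]. split; [exact Hab|]. intros t Ht.
    rewrite (Rmult_comm _ (M t)), (Cmult_comm h). now apply K.
  - rewrite (Cmult_comm I1). apply CI_minus; [now apply CI_minus|now apply CI_Cmult].
  - rewrite (Rmult_comm m). apply (is_RInt_gen_scal (V := R_NormedModule) M). exact HM.
Qed.

Lemma filter_prod_one_infty (P : R * R -> Prop) : (forall b, (1 <= b)%R -> P (1%R, b)) ->
  filter_prod (at_point 1%R) (Rbar_locally p_infty) P.
Proof.
  intros H. apply (Filter_prod _ _ _ (fun x => x = 1%R) (fun x => (1 < x)%R)).
  - reflexivity.
  - exists 1%R. auto.
  - intros x y -> Hy. apply H. lra.
Qed.

Lemma at_right_0_unit : at_right 0%R (fun t => 0 < t <= 1)%R.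
Proof.
  exists (mkposreal 1 Rlt_0_1). intros y Hy Hy0. split; [exact Hy0|].
  unfold ball in Hy; simpl in Hy; unfold AbsRing_ball, abs, minus, plus, opp in Hy; simpl in Hy.
  apply Rabs_def2 in Hy. lra.
Qed.

Lemma filter_prod_zero_one (P : R * R -> Prop) : (forall a, (0 < a <= 1)%R -> P (a, 1%R)) ->
  filter_prod (at_right 0%R) (at_point 1%R) P.
Proof.
  intros H. apply (Filter_prod _ _ _ (fun x => (0 < x <= 1)%R) (fun x => x = 1%R)).
  - apply at_right_0_unit.
  - reflexivity.
  - intros x y Hx ->. now apply H.
Qed.

(** Convergence by domination: the partial integrals of [f] are Cauchy because
    their increments are bounded by those of the antiderivative [G] of [g]. *)
Lemma ex_CI_dom (F : (R -> Prop) -> Prop) {FF : ProperFilter F} (f : R -> C) (g G : R -> R)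
  (D : R -> Prop) (L : R) :
  D 1%R -> F D ->
  (forall x y t, D x -> D y -> (Rmin x y <= t <= Rmax x y)%R -> D t) ->
  (forall t, D t -> Ccontinuous f t /\ is_derive G t (g t) /\ continuous g t /\
     (Cmod (f t) <= g t)%R) ->
  filterlim G F (locally L) ->
  exists l, CI f (at_point 1%R) F l.
Proof.
  intros D1 FD Dconv H HG.
  pose (If := fun x => RInt (V := C_R_CompleteNormedModule) f 1%R x).
  assert (HI : forall x, D x -> CRInt f 1%R x (If x)).
  { intros x Dx. apply (RInt_correct (V := C_R_CompleteNormedModule)).
    apply ex_CRInt. intros t Ht. apply H. now apply (Dconv 1%R x). }
  assert (Hle : forall x y, D x -> D y -> (x <= y)%R ->
     (Cmod (If y - If x)%C <= G y - G x)%R).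
  { intros x y Dx Dy Hxy.
    apply (CRInt_bound f g x y); [exact Hxy| | |].
    - intros t Ht. apply H. apply (Dconv x y); auto. now rewrite Rmin_left, Rmax_right.
    - replace (If y - If x) with (plus (G := C_R_NormedModule) (opp (If x)) (If y)).
      2:{ change (- If x + If y = If y - If x). ring. }
      apply (is_RInt_Chasles (V := C_R_NormedModule)) with 1%R; [|now apply HI].
      apply (is_RInt_swap (V := C_R_NormedModule)). now apply HI.
    - apply (is_RInt_derive (V := R_CompleteNormedModule) G g); intros t Ht; apply H; now apply (Dconv x y). }
  assert (Habs : forall x y, D x -> D y -> (Cmod (If y - If x)%C <= Rabs (G y - G x))%R).
  { intros x y Dx Dy. destruct (Rle_dec x y) as [L1|L1].
    - eapply Rle_trans; [now apply Hle|apply Rle_abs].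
    - replace (If y - If x) with (- (If x - If y)) by ring. rewrite Cmod_opp, Rabs_minus_sym.
      eapply Rle_trans; [apply Hle; auto; lra|apply Rle_abs]. }
  destruct (proj1 (filterlim_locally_cauchy (U := C_R_CompleteNormedModule) (F := F) If)) as [l Hl].
  { intros eps.
    destruct (proj2 (filterlim_locally_cauchy (U := R_CompleteSpace) (F := F) G) (ex_intro _ L HG)
              (mkposreal (eps) (cond_pos eps))) as [P [FP HP]].
    exists (fun x => D x /\ P x). split; [now apply filter_and|].
    intros u v [Du Pu] [Dv Pv]. specialize (HP u v Pu Pv).
    apply (norm_compat1 (V := C_R_NormedModule)). rewrite norm_C_R.
    eapply Rle_lt_trans; [apply (Habs u v Du Dv)|]. exact HP. }
  exists l. apply CI_eps. intros eps He.
  assert (K : F (fun x => D x /\ (Cmod (If x - l)%C < eps)%R)).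
  { apply filter_and; [exact FD|].
    apply (Hl (fun y : C => (Cmod (y - l)%C < eps)%R)).
    apply (locally_le_locally_norm (V := C_R_NormedModule)).
    exists (mkposreal eps He). intros y Hy. unfold ball_norm in Hy. rewrite norm_C_R in Hy. exact Hy. }
  apply (Filter_prod _ _ _ _ _ (eq_refl : at_point 1%R (fun x => x = 1%R)) K).
  intros x y -> [Dy E]. exists (If y). split; [now apply HI|exact E].
Qed.

Lemma is_RInt_gen_at_1 (F : (R -> Prop) -> Prop) {FF : Filter F} (g G : R -> R) (L : R) :
  F (fun x => is_RInt g 1%R x (G x)) -> filterlim G F (locally L) ->
  is_RInt_gen g (at_point 1%R) F L.
Proof.
  intros H HG P HP. specialize (HG P HP).
  assert (K := filter_and (F := F) _ (fun x => P (G x)) H HG).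
  apply (Filter_prod _ _ _ _ _ (eq_refl : at_point 1%R (fun x => x = 1%R)) K).
  intros x y -> [Hy Py]. now exists (G y).
Qed.

Lemma exp_decay_lim (c d : R) : (0 < d)%R ->
  filterlim (fun t => c * exp (- d * t))%R (Rbar_locally p_infty) (locally 0%R).
Proof.
  intros Hd.
  change (is_lim (fun t => c * exp (- d * t))%R p_infty 0).
  replace (Finite 0) with (Rbar_mult c 0) by (simpl; f_equal; ring).
  apply is_lim_scal_l.
  apply (is_lim_comp exp (fun t => - d * t)%R p_infty 0 m_infty).
  - apply is_lim_exp_m.
  - replace m_infty with (Rbar_mult (- d)%R p_infty).
    + apply is_lim_scal_l. apply is_lim_id.
    + simpl. destruct (Rle_dec 0 (- d)) as [A|A]; [exfalso; lra|reflexivity].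
  - exists 0%R. intros; discriminate.
Qed.

Lemma is_RInt_exp_decay (c d x : R) : (0 < d)%R ->
  is_RInt (fun t => c * exp (- d * t))%R 1%R x (c * exp (- d) / d - c / d * exp (- d * x))%R.
Proof.
  intros Hd.
  replace (c * exp (- d) / d - c / d * exp (- d * x))%R
    with (minus (G := R_NormedModule) (- c / d * exp (- d * x))%R (- c / d * exp (- d * 1))%R).
  2:{ unfold minus, plus, opp; simpl. rewrite Rmult_1_r. field. lra. }
  apply (is_RInt_derive (V := R_CompleteNormedModule) (fun t => - c / d * exp (- d * t))%R).
  - intros t _. auto_derive; [exact I|]. field. lra.
  - intros t _. apply (ex_derive_continuous (K := R_AbsRing) (V := R_NormedModule)).
    auto_derive. exact I.
Qed.

Lemma is_RInt_gen_exp_infty (c d : R) : (0 < d)%R ->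
  is_RInt_gen (fun t => c * exp (- d * t))%R (at_point 1%R) (Rbar_locally p_infty) (c * exp (- d) / d)%R.
Proof.
  intros Hd.
  apply (is_RInt_gen_at_1 _ _ (fun x => c * exp (- d) / d - c / d * exp (- d * x))%R).
  - apply filter_forall. intros x. now apply is_RInt_exp_decay.
  - replace (c * exp (- d) / d)%R with (plus (G := R_NormedModule) (c * exp (- d) / d)%R (opp (G := R_NormedModule) 0%R)) at 1.
    2:{ unfold plus, opp; simpl. ring. }
    apply (filterlim_comp_2 (G := locally (c * exp (- d) / d)%R) (H := locally (opp (G := R_NormedModule) 0%R)) (fun _ => c * exp (- d) / d)%R (fun x => opp (G := R_NormedModule) (c / d * exp (- d * x))%R)).
    + apply filterlim_const.
    + eapply filterlim_comp; [now apply exp_decay_lim|].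
      apply (filterlim_opp (V := R_NormedModule)).
    + apply (filterlim_plus (V := R_NormedModule)).
Qed.

Lemma at_right_0_id : filterlim (fun t : R => t) (at_right 0%R) (locally 0%R).
Proof. intros P [e He]. exists e. intros y Hy _. now apply He. Qed.

Lemma linear_lim_0 (c m : R) : filterlim (fun t => c * t + m)%R (at_right 0%R) (locally m).
Proof.
  apply (filterlim_comp _ _ _ (fun t : R => t) (fun t => c * t + m)%R _ (locally 0%R)).
  - apply at_right_0_id.
  - assert (K : continuous (fun t => c * t + m)%R 0%R).
    { apply (ex_derive_continuous (K := R_AbsRing) (V := R_NormedModule)). auto_derive. exact I. }
    unfold continuous in K. rewrite Rmult_0_r, Rplus_0_l in K. exact K.
Qed.

Lemma is_RInt_gen_const_zero (c : R) :
  is_RInt_gen (fun _ : R => c) (at_right 0%R) (at_point 1%R) c.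
Proof.
  assert (E : opp (G := R_NormedModule) (- c)%R = c) by (unfold opp; simpl; ring).
  cut (is_RInt_gen (V := R_NormedModule) (fun _ : R => c) (at_right 0%R) (at_point 1%R)
         (opp (G := R_NormedModule) (- c)%R)); [now rewrite E|].
  apply (is_RInt_gen_swap (V := R_NormedModule)).
  apply (is_RInt_gen_at_1 _ _ (fun x => c * x + - c)%R).
  - apply filter_forall. intros x.
    replace (c * x + - c)%R with (scal (V := R_NormedModule) (x - 1)%R c).
    + apply (is_RInt_const (V := R_NormedModule)).
    + unfold scal; simpl; unfold mult; simpl. ring.
  - apply linear_lim_0.
Qed.

Lemma ex_CI_infty (f : R -> C) (c d : R) : (0 < d)%R ->
  (forall t, (1 <= t)%R -> Ccontinuous f t /\ (Cmod (f t) <= c * exp (- d * t))%R) ->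
  exists l, CI f (at_point 1%R) (Rbar_locally p_infty) l.
Proof.
  intros Hd H.
  apply (ex_CI_dom _ f (fun t => c * exp (- d * t))%R (fun t => - c / d * exp (- d * t))%R
          (fun t => (1 <= t)%R) 0).
  - lra.
  - exists 1%R. intros x Hx. lra.
  - intros x y t Hx Hy [Ht _]. apply Rle_trans with (Rmin x y); [|exact Ht]. now apply Rmin_glb.
  - intros t Ht. destruct (H t Ht) as [H1 H2]. split; [exact H1|split; [|split; [|exact H2]]].
    + auto_derive; [exact I|]. field. lra.
    + apply (ex_derive_continuous (K := R_AbsRing) (V := R_NormedModule)). auto_derive. exact I.
  - now apply exp_decay_lim.
Qed.

Lemma ex_CI_zero (f : R -> C) (c : R) :
  (forall t, (0 < t <= 1)%R -> Ccontinuous f t /\ (Cmod (f t) <= c)%R) ->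
  exists l, CI f (at_right 0%R) (at_point 1%R) l.
Proof.
  intros H.
  destruct (ex_CI_dom (at_right 0%R) f (fun _ => c) (fun t => c * t + 0)%R (fun t => (0 < t <= 1)%R) 0) as [l Hl].
  - lra.
  - apply at_right_0_unit.
  - intros x y t [Hx Hx1] [Hy Hy1] [Ht Ht1]. split.
    + apply Rlt_le_trans with (Rmin x y); [|exact Ht]. now apply Rmin_glb_lt.
    + apply Rle_trans with (Rmax x y); [exact Ht1|]. now apply Rmax_lub.
  - intros t Ht. destruct (H t Ht) as [H1 H2]. split; [exact H1|split; [|split; [|exact H2]]].
    + auto_derive; [exact I|]. ring.
    + apply continuous_const.
  - apply linear_lim_0.
  - exists (opp (G := C_R_NormedModule) l). apply (is_RInt_gen_swap (V := C_R_NormedModule)). exact Hl.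
Qed.

(** * Cauchy's theorem in the logarithmic coordinate *)

Definition locally_bounded (f : C -> C) : Prop :=
  forall r : R, exists M : R, forall w, (Cmod w <= r)%R -> (Cmod (f w) <= M)%R.

Lemma locally_bounded_const c : locally_bounded (fun _ => c).
Proof. intros r. exists (Cmod c). intros; lra. Qed.

Lemma locally_bounded_id : locally_bounded (fun w => w).
Proof. intros r. now exists r. Qed.

Lemma locally_bounded_plus f g : locally_bounded f -> locally_bounded g ->
  locally_bounded (fun w => f w + g w).
Proof.
  intros Hf Hg r. destruct (Hf r) as [M HM], (Hg r) as [N HN].
  exists (M + N)%R. intros w Hw. eapply Rle_trans; [apply Cmod_triangle|].
  apply Rplus_le_compat; auto.
Qed.

Lemma locally_bounded_mult f g : locally_bounded f -> locally_bounded g ->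
  locally_bounded (fun w => f w * g w).
Proof.
  intros Hf Hg r. destruct (Hf r) as [M HM], (Hg r) as [N HN].
  exists (M * N)%R. intros w Hw. rewrite Cmod_mult.
  apply Rmult_le_compat; auto using Cmod_ge_0.
Qed.

Lemma locally_bounded_Cexp f : locally_bounded f -> locally_bounded (fun w => Cexp (f w)).
Proof.
  intros Hf r. destruct (Hf r) as [M HM]. exists (exp M). intros w Hw.
  eapply Rle_trans; [apply Cmod_Cexp_le|]. apply exp_le. auto.
Qed.

(** Two complex derivatives, the second one bounded on discs: by [hol_taylor1] this
    gives the error bound of [hol_integral] on a rectangle.  An explicit bound, closed
    under sums and products, takes the place of a compactness argument. *)
Definition smooth (k : C -> C) : Prop :=
  exists k1 k2 : C -> C,
    (forall w, hol k w (k1 w)) /\ (forall w, hol k1 w (k2 w)) /\ locally_bounded k2.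

Lemma smooth_plus f g : smooth f -> smooth g -> smooth (fun w => f w + g w).
Proof.
  intros [f1 [f2 [A1 [A2 A3]]]] [g1 [g2 [B1 [B2 B3]]]].
  exists (fun w => f1 w + g1 w), (fun w => f2 w + g2 w).
  split; [|split]; [intros; now apply hol_plus|intros; now apply hol_plus|now apply locally_bounded_plus].
Qed.

Lemma hol_scal c f z l : hol f z l -> hol (fun w => c * f w) z (c * l).
Proof.
  intros H. eapply hol_val; [apply (hol_mult (fun _ => c) f z 0 l (hol_const c z) H)|ring].
Qed.

Lemma smooth_scal c f : smooth f -> smooth (fun w => c * f w).
Proof.
  intros [f1 [f2 [A1 [A2 A3]]]].
  exists (fun w => c * f1 w), (fun w => c * f2 w).
  split; [|split]; [intros; now apply hol_scal|intros; now apply hol_scal|].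
  apply locally_bounded_mult; [apply locally_bounded_const|exact A3].
Qed.

(** With [w = ln t] and [mu = b + 1], this is [t] times the integrand
    [t^b exp (p t^a + q t)]; the factor [t] comes from [dt = t dw]. *)
Definition kexp (a : R) (mu p q : C) (w : C) : C := Cexp (mu * w + p * Cexp (a * w) + q * Cexp w).

Lemma hol_Cexp_scal (c z : C) : hol (fun w => Cexp (c * w)) z (c * Cexp (c * z)).
Proof.
  apply (hol_comp Cexp (fun w => c * w) z); [apply hol_Cexp|].
  eapply hol_val; [apply (hol_scal c (fun w => w) z 1), hol_id|ring].
Qed.

Lemma smooth_kexp a mu p q : smooth (kexp a mu p q).
Proof.
  set (c1 := fun w => mu + p * (a * Cexp (a * w)) + q * Cexp w).
  set (c2 := fun w => p * (a * (a * Cexp (a * w))) + q * Cexp w).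
  assert (H0 : forall w, hol (fun w => mu * w + p * Cexp (a * w) + q * Cexp w) w (c1 w)).
  { intros w. apply hol_plus; [apply hol_plus|].
    - eapply hol_val; [apply (hol_scal mu (fun w => w) w 1), hol_id|ring].
    - apply hol_scal, hol_Cexp_scal.
    - apply hol_scal, hol_Cexp. }
  assert (H1 : forall w, hol c1 w (c2 w)).
  { intros w. apply hol_plus; [|apply hol_scal, hol_Cexp].
    eapply hol_val; [apply hol_plus; [exact (hol_const mu w)|]|].
    - apply hol_scal, hol_scal, hol_Cexp_scal.
    - ring. }
  assert (H2 : forall w, hol (kexp a mu p q) w (c1 w * kexp a mu p q w)).
  { intros w. apply (hol_comp Cexp _ w); [apply hol_Cexp|apply H0]. }
  exists (fun w => c1 w * kexp a mu p q w),
    (fun w => c2 w * kexp a mu p q w + c1 w * (c1 w * kexp a mu p q w)).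
  split; [exact H2|split].
  - intros w. apply hol_mult; auto.
  - assert (B1 : locally_bounded c1).
    { unfold c1; repeat first [apply locally_bounded_plus|apply locally_bounded_mult|
        apply locally_bounded_Cexp|apply locally_bounded_const|apply locally_bounded_id]. }
    assert (B2 : locally_bounded c2).
    { unfold c2; repeat first [apply locally_bounded_plus|apply locally_bounded_mult|
        apply locally_bounded_Cexp|apply locally_bounded_const|apply locally_bounded_id]. }
    assert (B0 : locally_bounded (kexp a mu p q)).
    { unfold kexp; repeat first [apply locally_bounded_plus|apply locally_bounded_mult|
        apply locally_bounded_Cexp|apply locally_bounded_const|apply locally_bounded_id]. }
    repeat first [assumption|apply locally_bounded_plus|apply locally_bounded_mult].
Qed.

Lemma curve_ln (q : C) (t : R) : (0 < t)%R -> curve (fun s => ln s + q) t (/ t)%R.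
Proof.
  intros Ht. destruct q as [q1 q2].
  apply (curve_ext (fun s => ((ln s + q1)%R, q2))).
  { intros s. unfold RtoC, Cplus; simpl. f_equal. ring. }
  unfold RtoC. apply curve_pair; auto_derive; auto; field; lra.
Qed.

Lemma continuous_ln_comp (H H' : C -> C) (q : C) (t : R) :
  (0 < t)%R -> (forall w, hol H w (H' w)) -> Ccontinuous (fun s => H (ln s + q)) t.
Proof.
  intros Ht HH. eapply curve_continuous.
  apply (hol_curve H (fun s => ln s + q)); [apply HH|now apply curve_ln].
Qed.

Lemma Ccontinuous_ext_pos (f g : R -> C) (t : R) : (0 < t)%R ->
  (forall s, (0 < s)%R -> f s = g s) -> Ccontinuous f t -> Ccontinuous g t.
Proof.
  intros Ht E. apply (continuous_ext_loc (T := R_UniformSpace) (U := C_UniformSpace)).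
  exists (mkposreal t Ht). intros y Hy. apply E.
  unfold ball in Hy; simpl in Hy; unfold AbsRing_ball, abs, minus, plus, opp in Hy; simpl in Hy.
  apply Rabs_def2 in Hy. lra.
Qed.

Lemma RtoC_inv_exp (s : R) : (0 < s)%R -> RtoC (/ s)%R = Cexp (- ln s)%R.
Proof. intros Hs. rewrite Cexp_RtoC, exp_Ropp, exp_ln by exact Hs. reflexivity. Qed.

(** On the half-line [/ s] is the entire function [Cexp (- w)] of [w = ln s]. *)
Lemma continuous_log_integrand k k1 (q : C) (t : R) : (0 < t)%R ->
  (forall w, hol k w (k1 w)) -> Ccontinuous (fun s => k (ln s + q) * (/ s)%R) t.
Proof.
  intros Ht Hk.
  apply (Ccontinuous_ext_pos (fun s => (fun w => k w * Cexp (- (1) * w + q)) (ln s + q)) _ t Ht).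
  - intros s Hs. rewrite RtoC_inv_exp by exact Hs. f_equal. f_equal. rewrite RtoC_opp. ring.
  - refine (continuous_ln_comp (fun w => k w * Cexp (- (1) * w + q)) _ q t Ht _).
    intros w. apply hol_mult; [apply Hk|].
    apply (hol_comp Cexp (fun w => - (1) * w + q) w); [apply hol_Cexp|].
    apply hol_plus; [apply (hol_scal _ (fun w => w)), hol_id|exact (hol_const q w)].
Qed.

Lemma filter_prod_points (x y : R) (P : R * R -> Prop) : P (x, y) -> filter_prod (at_point x) (at_point y) P.
Proof.
  intros H. apply (Filter_prod _ _ _ (fun u => u = x) (fun u => u = y)); [reflexivity|reflexivity|].
  intros u v -> ->. exact H.
Qed.

Lemma ln_between (x y s : R) : (0 < x)%R -> (x <= s <= y)%R -> (Rabs (ln s) <= Rabs (ln x) + Rabs (ln y))%R.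
Proof.
  intros Hx [H1 H2].
  assert (L1 : (ln x <= ln s)%R) by (destruct H1 as [H1| <-]; [left; apply ln_increasing; lra|lra]).
  assert (L2 : (ln s <= ln y)%R) by (destruct H2 as [H2| ->]; [left; apply ln_increasing; lra|lra]).
  assert (A := Rle_abs (ln y)). assert (B := Rle_abs (- ln x)). rewrite Rabs_Ropp in B.
  assert (C1 := Rabs_pos (ln x)). assert (C2 := Rabs_pos (ln y)).
  apply Rabs_le. lra.
Qed.

(** Cauchy's theorem for [k dw] on the rectangle with corners [ln x] and
    [ln y + i th], whose horizontal sides are written in the variable [s = exp (Re w)].
    The integral over the horizontal side at height [ph] has, as a function of [ph],
    the difference of the values of [Ci * k] at the two ends as derivative. *)
Lemma log_rectangle (k : C -> C) (x y th : R) (D : C) :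
  smooth k -> (0 < x <= y)%R -> (0 <= th)%R ->
  CRInt (fun s => k (ln s + th * Ci) * (/ s)%R - k (ln s) * (/ s)%R) x y D ->
  CRInt (fun ph : R => Ci * (k (ln y + ph * Ci) - k (ln x + ph * Ci))) 0%R th D.
Proof.
  intros [k1 [k2 [H1 [H2 B]]]] [Hx Hxy] Hth HD.
  pose (J := fun q => RInt (V := C_R_CompleteNormedModule) (fun s => k (ln s + q) * (/ s)%R) x y).
  assert (HJ : forall q, CRInt (fun s => k (ln s + q) * (/ s)%R) x y (J q)).
  { intros q. apply (RInt_correct (V := C_R_CompleteNormedModule)). apply ex_CRInt. intros t Ht.
    rewrite Rmin_left in Ht by exact Hxy.
    apply continuous_log_integrand with k1; [lra|exact H1]. }
  assert (HolJ : forall q, hol J q (k (ln y + q) - k (ln x + q))).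
  { intros q.
    destruct (B (Rabs (ln x) + Rabs (ln y) + Cmod q + 1)%R) as [M HM].
    apply (hol_integral (Fa := at_point x) (Fb := at_point y) (fun q s => k (ln s + q) * (/ s)%R)
             (fun s => k1 (ln s + q) * (/ s)%R) J _ q (fun _ => M * / x)%R ((y - x) * (M * / x))%R 1).
    - lra.
    - intros q'. apply is_RInt_gen_at_point. apply HJ.
    - apply is_RInt_gen_at_point. apply (CRInt_FTC (fun s => k (ln s + q))).
      intros t Ht. rewrite Rmin_left in Ht by exact Hxy. split.
      + apply (hol_curve k (fun s => ln s + q)); [apply H1|]. apply curve_ln. lra.
      + apply continuous_log_integrand with k2; [lra|exact H2].
    - apply is_RInt_gen_at_point. apply (is_RInt_const (V := R_NormedModule)).
    - apply filter_prod_points. simpl. split; [exact Hxy|]. intros t Ht h Hh.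
      replace (k (ln t + (q + h)) * (/ t)%R - k (ln t + q) * (/ t)%R - k1 (ln t + q) * (/ t)%R * h)
        with ((k ((ln t + q) + h) - k (ln t + q) - k1 (ln t + q) * h) * (/ t)%R)
        by (rewrite Cplus_assoc; ring).
      rewrite Cmod_mult, Cmod_R.
      assert (P : (0 < / t)%R) by (apply Rinv_0_lt_compat; lra).
      rewrite (Rabs_pos_eq (/ t)) by lra.
      assert (Q : (Cmod (k ((ln t + q) + h) - k (ln t + q) - k1 (ln t + q) * h)%C <= M * (Cmod h * Cmod h))%R).
      { apply (hol_taylor1 k k1 k2). intros u Hu. split; [apply H1|split; [apply H2|]].
        apply HM. eapply Rle_trans; [apply Cmod_triangle|].
        assert (L := Cmod_segment_le u h Hu).
        assert (L2 := Cmod_triangle (ln t) q). rewrite Cmod_R in L2.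
        assert (L3 := ln_between x y t Hx Ht). lra. }
      assert (I1 : (/ t <= / x)%R) by (apply Rinv_le_contravar; lra).
      eapply Rle_trans; [apply Rmult_le_compat; [apply Cmod_ge_0|lra|exact Q|exact I1]|].
      right; ring. }
  replace D with (J (th * Ci) - J (0%R * Ci)).
  - apply (CRInt_FTC (fun ph : R => J (ph * Ci))). intros t Ht. split.
    + rewrite Cmult_comm. apply (hol_curve J (fun ph : R => ph * Ci)); [apply HolJ|apply curve_scal_line].
    + eapply curve_continuous.
      apply (hol_curve (fun w => Ci * (k (ln y + w) - k (ln x + w))) (fun ph : R => ph * Ci)); [|apply curve_scal_line].
      apply hol_scal.
      assert (Sh : forall c w, hol (fun w => k (c + w)) w (k1 (c + w))).
      { intros c w. eapply hol_val; [apply (hol_comp k (fun w => c + w) w); [apply H1|]|].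
        - apply hol_plus; [exact (hol_const c w)|apply hol_id].
        - ring. }
      apply (hol_ext (fun w => k (ln y + w) + - (1) * k (ln x + w))); [intros; ring|].
      apply hol_plus; [apply Sh|]. apply hol_scal, Sh.
  - apply (CRInt_unique (fun s => k (ln s + th * Ci) * (/ s)%R - k (ln s) * (/ s)%R) x y); [|exact HD].
    apply (is_RInt_minus (V := C_R_NormedModule)); [apply HJ|].
    apply (is_RInt_ext (V := C_R_NormedModule) (fun s => k (ln s + 0%R * Ci) * (/ s)%R)); [|apply HJ].
    intros s _. now rewrite Cmult_0_l, Cplus_0_r.
Qed.

Lemma Cmod_le_eps_eq_0 (x : C) (K : R) : (forall eta, (0 < eta)%R -> (Cmod x <= eta * K)%R) -> x = 0.
Proof.
  intros H. apply Cmod_eq_0. apply Rle_antisym; [|apply Cmod_ge_0].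
  apply Rnot_lt_le. intros L.
  assert (P := Rabs_pos K). assert (A := Rle_abs K).
  assert (E : (0 < Cmod x / (2 * (Rabs K + 1)))%R) by (apply Rdiv_lt_0_compat; lra).
  specialize (H _ E).
  assert (Cmod x / (2 * (Rabs K + 1)) * K <= Cmod x / (2 * (Rabs K + 1)) * (Rabs K + 1))%R
    by (apply Rmult_le_compat_l; lra).
  replace (Cmod x / (2 * (Rabs K + 1)) * (Rabs K + 1))%R with (Cmod x / 2)%R in H0 by (field; lra).
  lra.
Qed.

(** The limit of [log_rectangle] as the right end goes to infinity with [k] tending
    to 0 there; the left end stays at [ln 1 = 0], and [W] is the integral over the
    vertical side there. *)
Lemma log_rotation_infty (k : C -> C) (th : R) (D W : C) :
  smooth k -> (0 <= th)%R ->
  CI (fun s => k (ln s + th * Ci) * (/ s)%R - k (ln s) * (/ s)%R)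
    (at_point 1%R) (Rbar_locally p_infty) D ->
  CRInt (fun ph : R => Ci * k (ph * Ci)) 0%R th W ->
  (forall eta, (0 < eta)%R -> exists X, forall y, (X <= y)%R -> forall ph, (0 <= ph <= th)%R ->
     (Cmod (k (ln y + ph * Ci)%C) <= eta)%R) ->
  D = - W.
Proof.
  intros Hk Hth HD HW Hlim.
  cut (D + W = 0). { intros E. replace D with (D + W - W) by ring. rewrite E. ring. }
  apply (Cmod_le_eps_eq_0 _ (th + 1)). intros eta He.
  destruct (Hlim eta He) as [X HX].
  destruct (proj1 (CI_eps _ _) HD eta He) as [Q1 Q2 HQ1 [N HQ2] HQ].
  set (y := Rmax 1 (Rmax X (N + 1))).
  assert (Y1 : (1 <= y)%R) by apply Rmax_l.
  assert (Y2 : (X <= y)%R) by (eapply Rle_trans; [|apply Rmax_r]; apply Rmax_l).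
  assert (Y3 : (N < y)%R).
  { apply Rlt_le_trans with (N + 1)%R; [lra|]. eapply Rle_trans; [|apply Rmax_r]; apply Rmax_r. }
  destruct (HQ 1%R y HQ1 (HQ2 y Y3)) as [d [Hd Ed]]. simpl in Hd.
  apply log_rectangle in Hd; [|exact Hk|lra|exact Hth].
  assert (Hs : CRInt (fun ph : R => Ci * k (ln y + ph * Ci)) 0%R th (d + W)).
  { apply (is_RInt_ext (V := C_R_NormedModule)
      (fun ph : R => Ci * (k (ln y + ph * Ci) - k (ln 1 + ph * Ci)) + Ci * k (ph * Ci))).
    - intros ph _. rewrite ln_1, Cplus_0_l.
      assert (E : forall u v : C, Ci * (u - v) + Ci * v = Ci * u) by (intros; ring). apply E.
    - now apply (is_RInt_plus (V := C_R_NormedModule)). }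
  assert (Bs : (Cmod (d + W)%C <= th * eta)%R).
  { apply (CRInt_bound _ (fun _ => eta) _ _ _ (th * eta)%R Hth) in Hs; [exact Hs| |].
    - intros t Ht. rewrite Cmod_mult. unfold Ci at 1.
      replace (Cmod (0%R, 1%R)) with 1%R; [rewrite Rmult_1_l; now apply HX|].
      unfold Cmod; simpl. symmetry. replace (0 * (0 * 1) + 1 * (1 * 1))%R with 1%R by ring. apply sqrt_1.
    - replace (th * eta)%R with (scal (V := R_NormedModule) (th - 0)%R eta).
      + apply (is_RInt_const (V := R_NormedModule)).
      + unfold scal; simpl; unfold mult; simpl; ring. }
  replace (D + W) with ((d + W) - (d - D)) by ring.
  eapply Rle_trans; [apply Cmod_triangle|]. rewrite Cmod_opp. lra.
Qed.

(** The limit of [log_rectangle] as the left end goes to minus infinity with [k]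
    tending to 0 there; the right end stays at [ln 1 = 0]. *)
Lemma log_rotation_zero (k : C -> C) (th : R) (D W : C) :
  smooth k -> (0 <= th)%R ->
  CI (fun s => k (ln s + th * Ci) * (/ s)%R - k (ln s) * (/ s)%R)
    (at_right 0%R) (at_point 1%R) D ->
  CRInt (fun ph : R => Ci * k (ph * Ci)) 0%R th W ->
  (forall eta, (0 < eta)%R -> exists X, (0 < X)%R /\
     forall y, (0 < y <= X)%R -> forall ph, (0 <= ph <= th)%R ->
     (Cmod (k (ln y + ph * Ci)%C) <= eta)%R) ->
  D = W.
Proof.
  intros Hk Hth HD HW Hlim.
  cut (D - W = 0). { intros E. replace D with (D - W + W) by ring. rewrite E. ring. }
  apply (Cmod_le_eps_eq_0 _ (th + 1)). intros eta He.
  destruct (Hlim eta He) as [X [HX0 HX]].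
  destruct (proj1 (CI_eps _ _) HD eta He) as [Q1 Q2 [N HQ1] HQ2 HQ].
  set (y := Rmin 1 (Rmin X (N / 2))).
  assert (PN := cond_pos N).
  assert (Y0 : (0 < y)%R) by (repeat apply Rmin_pos; lra).
  assert (Y1 : (y <= 1)%R) by apply Rmin_l.
  assert (Y2 : (y <= X)%R) by (eapply Rle_trans; [apply Rmin_r|]; apply Rmin_l).
  assert (Y3 : (y < N)%R).
  { apply Rle_lt_trans with (N / 2)%R; [|lra]. eapply Rle_trans; [apply Rmin_r|]; apply Rmin_r. }
  assert (Q1y : Q1 y).
  { apply HQ1; [|exact Y0].
    unfold ball; simpl; unfold AbsRing_ball, abs, minus, plus, opp; simpl.
    rewrite Rabs_pos_eq; lra. }
  destruct (HQ y 1%R Q1y HQ2) as [d [Hd Ed]]. simpl in Hd.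
  apply log_rectangle in Hd; [|exact Hk|lra|exact Hth].
  assert (Hs : CRInt (fun ph : R => Ci * k (ln y + ph * Ci)) 0%R th (W - d)).
  { apply (is_RInt_ext (V := C_R_NormedModule)
      (fun ph : R => Ci * k (ph * Ci) - Ci * (k (ln 1 + ph * Ci) - k (ln y + ph * Ci)))).
    - intros ph _. rewrite ln_1, Cplus_0_l.
      assert (E : forall u v : C, Ci * u - Ci * (u - v) = Ci * v) by (intros; ring). apply E.
    - now apply (is_RInt_minus (V := C_R_NormedModule)). }
  assert (Bs : (Cmod (W - d)%C <= th * eta)%R).
  { apply (CRInt_bound _ (fun _ => eta) _ _ _ (th * eta)%R Hth) in Hs; [exact Hs| |].
    - intros t Ht. rewrite Cmod_mult. unfold Ci at 1.
      replace (Cmod (0%R, 1%R)) with 1%R; [rewrite Rmult_1_l; apply HX; lra|].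
      unfold Cmod; simpl. symmetry. replace (0 * (0 * 1) + 1 * (1 * 1))%R with 1%R by ring. apply sqrt_1.
    - replace (th * eta)%R with (scal (V := R_NormedModule) (th - 0)%R eta).
      + apply (is_RInt_const (V := R_NormedModule)).
      + unfold scal; simpl; unfold mult; simpl; ring. }
  replace (D - W) with (- ((W - d) + (d - D))) by ring. rewrite Cmod_opp.
  eapply Rle_trans; [apply Cmod_triangle|]. lra.
Qed.

(** * The truncated double series *)

Lemma sum_pairs_ext b (f g : nat -> nat -> C) :
  (forall m n, f m n = g m n) -> sum_pairs b f = sum_pairs b g.
Proof. intros H. unfold sum_pairs. apply sum_n_ext. intros m. apply sum_n_ext. intros n. apply H. Qed.

Lemma sum_pairs_plus b (f g : nat -> nat -> C) :
  sum_pairs b (fun m n => f m n + g m n) = sum_pairs b f + sum_pairs b g.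
Proof.
  unfold sum_pairs. change Cplus with (@plus C_AbelianGroup). rewrite <- sum_n_plus.
  apply sum_n_ext. intros m. rewrite <- sum_n_plus. reflexivity.
Qed.

Lemma sum_pairs_scal b (c : C) (f : nat -> nat -> C) :
  sum_pairs b (fun m n => c * f m n) = c * sum_pairs b f.
Proof.
  unfold sum_pairs. change Cmult with (@mult C_Ring).
  rewrite <- (sum_n_mult_l (K := C_Ring)).
  apply sum_n_ext. intros m. rewrite <- (sum_n_mult_l (K := C_Ring)). reflexivity.
Qed.

Lemma sum_pairs_minus b (f g : nat -> nat -> C) :
  sum_pairs b (fun m n => f m n - g m n) = sum_pairs b f - sum_pairs b g.
Proof.
  replace (sum_pairs b f - sum_pairs b g) with (sum_pairs b f + - (1) * sum_pairs b g) by ring.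
  rewrite <- sum_pairs_scal, <- sum_pairs_plus. apply sum_pairs_ext. intros; ring.
Qed.

Lemma sum_pairs_ind {T : Type} (P : (T -> C) -> Prop) b (f : T -> nat -> nat -> C) :
  (forall g h, (forall t, g t = h t) -> P g -> P h) ->
  (forall g h, P g -> P h -> P (fun t => g t + h t)) ->
  (forall m n, P (fun t => f t m n)) ->
  P (fun t => sum_pairs b (f t)).
Proof.
  intros He Hp Hf. unfold sum_pairs.
  assert (S1 : forall (g : T -> nat -> C) k, (forall m, P (fun t => g t m)) -> P (fun t => sum_n (g t) k)).
  { intros g k Hg. induction k as [|k IH].
    - apply (He (fun t => g t 0%nat)); [|apply Hg]. intros t. now rewrite sum_O.
    - apply (He (fun t => sum_n (g t) k + g t (S k))); [|now apply Hp].
      intros t. now rewrite sum_Sn. }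
  apply S1. intros m. apply (S1 (fun t n => f t m n)). intros n. apply Hf.
Qed.

Lemma expsum_sum_n k (x : C) : expsum (S k) x = sum_n (fun j => x ^ j / INR (fact j)) k.
Proof.
  induction k as [|k IH].
  - rewrite sum_O. change (0 + x ^ 0 / INR (fact 0) = x ^ 0 / INR (fact 0)). ring.
  - rewrite sum_Sn, <- IH. reflexivity.
Qed.

(** The coefficient of [t^(n a + m)] in the expansion of [exp (p t^a + q t)]. *)
Definition coef (p q : C) (m n : nat) : C := p ^ n * q ^ m / (INR (fact n) * INR (fact m)).

Lemma expsum_mult b (x y : C) :
  expsum (S (index_bound b)) x * expsum (S (index_bound b)) y = sum_pairs b (coef x y).
Proof.
  rewrite !expsum_sum_n. unfold sum_pairs.
  rewrite Cmult_comm. change Cmult with (@mult C_Ring) at 1.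
  rewrite <- (sum_n_mult_r (K := C_Ring)).
  apply sum_n_ext. intros m. rewrite <- (sum_n_mult_l (K := C_Ring)).
  apply sum_n_ext. intros n. unfold coef.
  change (y ^ m / INR (fact m) * (x ^ n / INR (fact n)) = x ^ n * y ^ m / (INR (fact n) * INR (fact m))).
  field. split; apply INR_fact_neq_0_C.
Qed.

Lemma index_bound_gt (b : C) : (0 < Re b + INR (index_bound b))%R.
Proof.
  unfold index_bound. destruct (archimed (- Re b)%R) as [H _].
  destruct (Z_lt_le_dec (up (- Re b)%R) 0) as [L|L].
  - apply (IZR_lt _ 0) in L. assert (P := pos_INR (Z.to_nat (up (- Re b)%R))). lra.
  - rewrite INR_IZR_INZ, Z2Nat.id by exact L. lra.
Qed.

Lemma Rpower_C (t x : R) : RtoC (Rpower t x) = Cexp (x * ln t).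
Proof. unfold Rpower. rewrite <- Cexp_RtoC, RtoC_mult. reflexivity. Qed.

Lemma exp_ln_C (t : R) : (0 < t)%R -> RtoC t = Cexp (ln t).
Proof. intros H. rewrite Cexp_RtoC, exp_ln by exact H. reflexivity. Qed.

Definition fexp (a : R) (p q : C) (t : R) : C := Cexp (p * Rpower t a + q * t).
(** A full square of terms, rather than the terms with [m + n a + Re b <= -1], so
    that it factors and its error follows from [Cexp_remainder]. *)
Definition trunc (a : R) (b p q : C) (t : R) : C :=
  expsum (S (index_bound b)) (p * Rpower t a) * expsum (S (index_bound b)) (q * t).

(** [trunc] written as [kexp a (b + 1) p q] is. *)
Definition ktrunc (a : R) (b p q w : C) : C :=
  Cexp ((b + 1) * w) *
  (expsum (S (index_bound b)) (p * Cexp (a * w)) * expsum (S (index_bound b)) (q * Cexp w)).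

Lemma coef_Cexp a p q m n (w : C) :
  coef (p * Cexp (a * w)) (q * Cexp w) m n = coef p q m n * Cexp ((INR n * a + INR m) * w).
Proof.
  unfold coef. rewrite !Cpow_mult_l, <- !Cexp_INR_mul.
  replace ((INR n * a + INR m) * w) with (INR n * (a * w) + INR m * w) by ring.
  rewrite Cexp_plus. field. split; apply INR_fact_neq_0_C.
Qed.

Lemma ktrunc_sum a b p q w :
  ktrunc a b p q w = sum_pairs b (fun m n => coef p q m n * Cexp ((b + INR n * a + INR m + 1) * w)).
Proof.
  unfold ktrunc. rewrite expsum_mult, <- sum_pairs_scal. apply sum_pairs_ext. intros m n.
  rewrite coef_Cexp.
  replace ((b + INR n * a + INR m + 1) * w) with ((b + 1) * w + (INR n * a + INR m) * w) by ring.
  rewrite Cexp_plus. ring.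
Qed.

(** Shifting [w] by [i ph] turns the parameters [p] and [q] and produces the factor
    [e^(i (b + 1) ph)]. *)
Lemma kexp_log a b p q (t ph : R) : (0 < t)%R ->
  kexp a (b + 1) p q (ln t + ph * Ci) =
  t * (Cexp ((b + 1) * (ph * Ci)) * (Rcpow t b * fexp a (p * Cexp (a * (ph * Ci))) (q * Cexp (ph * Ci)) t)).
Proof.
  intros Ht. unfold kexp, fexp, Rcpow. rewrite Rpower_C, (exp_ln_C t Ht), <- !Cexp_plus.
  f_equal.
  replace (a * (ln t + ph * Ci)) with (a * ln t + a * (ph * Ci)) by ring.
  rewrite !Cexp_plus. ring.
Qed.

Lemma ktrunc_log a b p q (t ph : R) : (0 < t)%R ->
  ktrunc a b p q (ln t + ph * Ci) =
  t * (Cexp ((b + 1) * (ph * Ci)) * (Rcpow t b * trunc a b (p * Cexp (a * (ph * Ci))) (q * Cexp (ph * Ci)) t)).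
Proof.
  intros Ht. unfold ktrunc, trunc, Rcpow. rewrite Rpower_C.
  replace (q * Cexp (ph * Ci) * t) with (q * Cexp (ln t + ph * Ci))
    by (rewrite Cexp_plus, <- (exp_ln_C t Ht); ring).
  replace (p * Cexp (a * (ph * Ci)) * Cexp (a * ln t)) with (p * Cexp (a * (ln t + ph * Ci))).
  2:{ replace (a * (ln t + ph * Ci)) with (a * ln t + a * (ph * Ci)) by ring. rewrite Cexp_plus; ring. }
  replace ((b + 1) * (ln t + ph * Ci)) with ((b + 1) * (ph * Ci) + (b * ln t + ln t)) by ring.
  rewrite (Cexp_plus ((b + 1) * (ph * Ci))), (Cexp_plus (b * ln t)), <- (exp_ln_C t Ht). ring.
Qed.

Lemma trunc_sum a b p q t : (0 < t)%R ->
  trunc a b p q t = sum_pairs b (fun m n => coef p q m n * Rpower t (INR n * a + INR m)%R).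
Proof.
  intros Ht. unfold trunc. rewrite Rpower_C. rewrite (exp_ln_C t Ht).
  rewrite expsum_mult. apply sum_pairs_ext. intros m n. rewrite coef_Cexp, Rpower_C.
  now rewrite RtoC_plus, RtoC_mult.
Qed.

Lemma smooth_ext f g : (forall w, f w = g w) -> smooth f -> smooth g.
Proof.
  intros E [f1 [f2 [A1 A2]]]. exists f1, f2. split; [|exact A2].
  intros w. now apply (hol_ext f).
Qed.

Lemma smooth_Cexp_scal (mu : C) : smooth (fun w => Cexp (mu * w)).
Proof.
  apply (smooth_ext (kexp 1 mu 0 0)); [|apply smooth_kexp].
  intros w. unfold kexp. f_equal. ring.
Qed.

(** As a function of [w], the truncation is a combination of exponentials. *)
Lemma smooth_ktrunc a b p q : smooth (ktrunc a b p q).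
Proof.
  apply (smooth_ext (fun w => sum_pairs b (fun m n => coef p q m n * Cexp ((b + INR n * a + INR m + 1) * w)))).
  { intros w. now rewrite ktrunc_sum. }
  apply sum_pairs_ind; [apply smooth_ext|apply smooth_plus|].
  intros m n. apply smooth_scal, smooth_Cexp_scal.
Qed.

Lemma Cmod_Rcpow (t : R) (b : C) : Cmod (Rcpow t b) = exp (Re b * ln t).
Proof. unfold Rcpow. rewrite Cmod_Cexp, re_scal_r. reflexivity. Qed.

Lemma ln_le_0 t : (0 < t <= 1)%R -> (ln t <= 0)%R.
Proof.
  intros [H [L| ->]]; [|rewrite ln_1; lra]. left. rewrite <- ln_1. now apply ln_increasing.
Qed.

Lemma pow_le_1_le (t : R) (i j : nat) : (0 <= t <= 1)%R -> (j <= i)%nat -> (t ^ i <= t ^ j)%R.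
Proof.
  intros Ht Hij. replace i with (j + (i - j))%nat by lia. rewrite pow_add.
  assert (P := pow_le t j (proj1 Ht)).
  assert (Q : (t ^ (i - j) <= 1)%R) by (rewrite <- (pow1 (i - j)); now apply pow_incr).
  nra.
Qed.

(** The reason for truncating at [index_bound b]: [Re b + index_bound b > 0]. *)
Lemma Rcpow_index_bound (b : C) (t : R) : (0 < t <= 1)%R ->
  (Cmod (Rcpow t b) * t ^ S (index_bound b) <= t)%R.
Proof.
  intros Ht. rewrite Cmod_Rcpow.
  replace (t ^ S (index_bound b))%R with (exp (INR (S (index_bound b)) * ln t)).
  2:{ fold (Rpower t (INR (S (index_bound b)))). now rewrite Rpower_pow. }
  rewrite <- exp_plus. rewrite <- (exp_ln t) at 3 by lra.
  apply exp_le. assert (L := ln_le_0 t Ht). assert (G := index_bound_gt b).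
  rewrite S_INR. nra.
Qed.

Lemma Rpower_le_id a t : (1 < a)%R -> (0 < t <= 1)%R -> (0 < Rpower t a <= t)%R.
Proof.
  intros Ha Ht. unfold Rpower. split; [apply exp_pos|].
  rewrite <- (exp_ln t) at 2 by lra. apply exp_le. assert (L := ln_le_0 t Ht). nra.
Qed.

(** The degrees of the two Taylor polynomials may differ, since differentiation in
    [q] lowers only the second one. *)
Lemma remainder_bound (a : R) (p q : C) (P Q t : R) (N k : nat) :
  (1 < a)%R -> (Cmod p <= P)%R -> (Cmod q <= Q)%R -> (0 < t <= 1)%R -> (k <= N)%nat ->
  (Cmod (fexp a p q t - expsum N (p * Rpower t a) * expsum k (q * t))%C
    <= exp (P + Q) * (Q ^ k + P ^ N * (1 + Q ^ k)) * t ^ k)%R.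
Proof.
  intros Ha Hp Hq Ht Hk. unfold fexp. rewrite Cexp_plus.
  set (u := p * Rpower t a). set (v := q * t).
  assert (Pt := Rpower_le_id a t Ha Ht).
  assert (Pp := Cmod_ge_0 p). assert (Pq := Cmod_ge_0 q).
  assert (Hu : (Cmod u <= P * t)%R).
  { unfold u. rewrite Cmod_mult, Cmod_R, Rabs_pos_eq by lra. apply Rmult_le_compat; lra. }
  assert (Hv : (Cmod v <= Q * t)%R).
  { unfold v. rewrite Cmod_mult, Cmod_R, Rabs_pos_eq by lra. apply Rmult_le_compat; lra. }
  assert (Hu1 : (Cmod u <= P)%R) by nra. assert (Hv1 : (Cmod v <= Q)%R) by nra.
  assert (P0 : (0 <= P)%R) by lra. assert (Q0 : (0 <= Q)%R) by lra.
  assert (Pu := Cmod_ge_0 u). assert (Pv := Cmod_ge_0 v).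
  assert (Tk := pow_le t k (Rlt_le _ _ (proj1 Ht))).
  assert (Qk := pow_le Q k Q0). assert (PN := pow_le P N P0).
  assert (Ru : (Cmod (Cexp u - expsum N u)%C <= P ^ N * t ^ k * exp P)%R).
  { eapply Rle_trans; [apply Cexp_remainder|].
    apply Rmult_le_compat; [now apply pow_le|left; apply exp_pos| |now apply exp_le].
    apply Rle_trans with ((P * t) ^ N)%R; [now apply pow_incr|].
    rewrite Rpow_mult_distr. apply Rmult_le_compat_l; [exact PN|]. apply pow_le_1_le; [lra|exact Hk]. }
  assert (Rv : (Cmod (Cexp v - expsum k v)%C <= Q ^ k * t ^ k * exp Q)%R).
  { eapply Rle_trans; [apply Cexp_remainder|].
    apply Rmult_le_compat; [now apply pow_le|left; apply exp_pos| |now apply exp_le].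
    rewrite <- Rpow_mult_distr. now apply pow_incr. }
  assert (Eu : (Cmod (Cexp u) <= exp P)%R) by (eapply Rle_trans; [apply Cmod_Cexp_le|now apply exp_le]).
  assert (Ev : (Cmod (Cexp v) <= exp Q)%R) by (eapply Rle_trans; [apply Cmod_Cexp_le|now apply exp_le]).
  assert (XP := exp_pos P). assert (XQ := exp_pos Q).
  assert (T1 : (t ^ k <= 1)%R) by (rewrite <- (pow1 k); apply pow_incr; lra).
  assert (Sv : (Cmod (expsum k v) <= (1 + Q ^ k) * exp Q)%R).
  { replace (expsum k v) with (Cexp v - (Cexp v - expsum k v)) by ring.
    eapply Rle_trans; [apply Cmod_triangle|]. rewrite Cmod_opp.
    assert (Q ^ k * t ^ k * exp Q <= Q ^ k * exp Q)%R.
    { apply Rmult_le_compat_r; [lra|]. nra. }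
    lra. }
  replace (Cexp u * Cexp v - expsum N u * expsum k v)
    with (Cexp u * (Cexp v - expsum k v) + (Cexp u - expsum N u) * expsum k v) by ring.
  eapply Rle_trans; [apply Cmod_triangle|]. rewrite !Cmod_mult, exp_plus.
  apply Rle_trans with (exp P * (Q ^ k * t ^ k * exp Q) + (P ^ N * t ^ k * exp P) * ((1 + Q ^ k) * exp Q))%R.
  - apply Rplus_le_compat; apply Rmult_le_compat; auto using Cmod_ge_0.
  - right; ring.
Qed.

(** The family of integrands, closed under differentiation in [q].  The truncated
    integrand is the case [j = 0], [k = S (index_bound b)]; for [k = 0] the sum
    [expsum 0] is 0 and the integrand is the one without truncation. *)
Definition rem (a : R) (b p : C) (j k : nat) (q : C) (t : R) : C :=
  Rcpow t b * (t ^ j * (fexp a p q t - expsum (S (index_bound b)) (p * Rpower t a) * expsum k (q * t))).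

Lemma hol_rem a b p j k q t : hol (fun q => rem a b p j k q t) q (rem a b p (S j) (pred k) q t).
Proof.
  set (E := expsum (S (index_bound b)) (p * Rpower t a)).
  assert (Hf : hol (fun q => fexp a p q t) q (t * fexp a p q t)).
  { apply (hol_comp Cexp (fun q => p * Rpower t a + q * t) q); [apply hol_Cexp|].
    eapply hol_val; [apply hol_plus; [exact (hol_const (p * Rpower t a) q)|]|].
    - apply (hol_mult (fun w => w) (fun _ => RtoC t)); [apply hol_id|apply hol_const].
    - ring. }
  assert (Hg : hol (fun q => expsum k (q * t)) q (t * expsum (pred k) (q * t))).
  { apply (hol_comp (expsum k) (fun q => q * t) q); [apply hol_expsum|].
    eapply hol_val; [apply (hol_mult (fun w => w) (fun _ => RtoC t)); [apply hol_id|apply hol_const]|].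
    ring. }
  apply (hol_ext (fun q => (Rcpow t b * t ^ j) * (fexp a p q t + - E * expsum k (q * t)))).
  { intros w. unfold rem. fold E. ring. }
  eapply hol_val; [apply hol_scal, hol_plus; [exact Hf|apply hol_scal; exact Hg]|].
  unfold rem. fold E. simpl. ring.
Qed.

Lemma rem_bound (a : R) (b : C) (j k : nat) (P Q : R) :
  (1 < a)%R -> (0 <= P)%R -> (0 <= Q)%R ->
  (k <= S (index_bound b) <= j + k)%nat ->
  exists M, (0 <= M)%R /\ forall p q t, (Cmod p <= P)%R -> (Cmod q <= Q)%R -> (0 < t <= 1)%R ->
    (Cmod (rem a b p j k q t) <= M * t)%R.
Proof.
  intros Ha P0 Q0 Hjk. set (N := S (index_bound b)) in *.
  exists (exp (P + Q) * (Q ^ k + P ^ N * (1 + Q ^ k)))%R.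
  assert (M0 : (0 <= exp (P + Q) * (Q ^ k + P ^ N * (1 + Q ^ k)))%R).
  { assert (A := pow_le P N P0). assert (B := pow_le Q k Q0). assert (E := exp_pos (P + Q)).
    apply Rmult_le_pos; [lra|]. nra. }
  split; [exact M0|]. intros p q t Hp Hq Ht. unfold rem. fold N.
  rewrite !Cmod_mult, <- RtoC_pow, Cmod_R, Rabs_pos_eq by (apply pow_le; lra).
  assert (R := remainder_bound a p q P Q t N k Ha Hp Hq Ht (proj1 Hjk)).
  assert (B := Rcpow_index_bound b t Ht). fold N in B.
  assert (Tj := pow_le t j (Rlt_le _ _ (proj1 Ht))).
  assert (L : (t ^ (j + k) <= t ^ N)%R) by (apply pow_le_1_le; [lra|lia]).
  rewrite pow_add in L.
  eapply Rle_trans.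
  { apply Rmult_le_compat_l; [apply Cmod_ge_0|]. apply Rmult_le_compat_l; [exact Tj|exact R]. }
  replace (Cmod (Rcpow t b) * (t ^ j * (exp (P + Q) * (Q ^ k + P ^ N * (1 + Q ^ k)) * t ^ k)))%R
    with (exp (P + Q) * (Q ^ k + P ^ N * (1 + Q ^ k)) * (Cmod (Rcpow t b) * (t ^ j * t ^ k)))%R by ring.
  apply Rmult_le_compat_l; [exact M0|].
  eapply Rle_trans; [|exact B]. apply Rmult_le_compat_l; [apply Cmod_ge_0|exact L].
Qed.

(** The integral of [t^(mu - 1)] over the unit interval. *)
Lemma CI_power (mu : C) : (0 < Re mu)%R ->
  CI (fun t => Cexp (mu * ln t) * (/ t)%R) (at_right 0%R) (at_point 1%R) (/ mu).
Proof.
  intros Hmu.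
  assert (mu0 : mu <> 0) by (intros E; rewrite E in Hmu; simpl in Hmu; lra).
  assert (Pm := proj1 (Cmod_gt_0 mu) mu0).
  apply CI_eps. intros eps He.
  (* X solves X^(Re mu) / |mu| = eps. *)
  set (X := exp (ln (eps * Cmod mu) / Re mu)).
  assert (HX : (0 < X)%R) by apply exp_pos.
  apply (Filter_prod _ _ _ (fun x => 0 < x /\ x <= 1 /\ x < X)%R (fun x => x = 1%R)).
  - generalize at_right_0_unit. 
    assert (K : at_right 0%R (fun x => (x < X)%R)).
    { exists (mkposreal X HX). intros y Hy _.
      unfold ball in Hy; simpl in Hy; unfold AbsRing_ball, abs, minus, plus, opp in Hy; simpl in Hy.
      apply Rabs_def2 in Hy. lra. }
    intros K2. generalize (filter_and _ _ K K2). apply filter_imp. intros x; tauto.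
  - reflexivity.
  - intros x y [Hx [Hx1 HxX]] ->. simpl.
    exists (/ mu * Cexp (mu * ln 1) - / mu * Cexp (mu * ln x)). split.
    + apply (CRInt_FTC (fun t => / mu * Cexp (mu * ln t))).
      intros t Ht. rewrite Rmin_left in Ht by exact Hx1. assert (Ht0 : (0 < t)%R) by lra. split.
      * assert (Hc := hol_curve (fun w => / mu * Cexp (mu * w)) (fun s => ln s + 0) t _ _
            (hol_scal _ _ _ _ (hol_Cexp_scal mu (ln t + 0))) (curve_ln 0 t Ht0)).
        apply (curve_ext _ (fun t => / mu * Cexp (mu * ln t))) in Hc;
          [|intros s; now rewrite Cplus_0_r].
        rewrite Cplus_0_r in Hc. rewrite Cmult_assoc, Cinv_l, Cmult_1_l in Hc by exact mu0. exact Hc.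
      * apply (Ccontinuous_ext_pos (fun s => Cexp (mu * (ln s + 0)) * (/ s)%R) _ t Ht0).
        { intros s _. now rewrite Cplus_0_r. }
        apply (continuous_log_integrand (fun w => Cexp (mu * w)) _ 0 t Ht0 (hol_Cexp_scal mu)).
    + rewrite ln_1, Cmult_0_r, Cexp_0.
      replace (/ mu * 1 - / mu * Cexp (mu * ln x) - / mu) with (- (/ mu * Cexp (mu * ln x))) by ring.
      rewrite Cmod_opp, Cmod_mult, Cmod_inv by exact mu0.
      rewrite Cmod_Cexp, re_scal_r.
      apply (Rmult_lt_reg_l (Cmod mu)); [exact Pm|].
      rewrite <- Rmult_assoc, Rinv_r, Rmult_1_l by lra.
      assert (EP : (0 < eps * Cmod mu)%R) by (apply Rmult_lt_0_compat; lra).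
      rewrite (Rmult_comm (Cmod mu)). rewrite <- (exp_ln (eps * Cmod mu)) by exact EP.
      apply exp_increasing.
      apply ln_increasing in HxX; [|exact Hx]. unfold X in HxX. rewrite ln_exp in HxX.
      apply Rlt_div_r in HxX; [|exact Hmu]. lra.
Qed.

Lemma CI_ext {Fa Fb : (R -> Prop) -> Prop} {FFa : Filter Fa} {FFb : Filter Fb} (f g : R -> C) (l : C) :
  filter_prod Fa Fb (fun ab => (fst ab <= snd ab)%R /\
    forall t, (fst ab < t < snd ab)%R -> f t = g t) ->
  CI f Fa Fb l -> CI g Fa Fb l.
Proof.
  intros H. apply (is_RInt_gen_ext (V := C_R_NormedModule)).
  generalize H. apply filter_imp. intros ab [Hab K] t Ht.
  rewrite Rmin_left, Rmax_right in Ht by exact Hab. now apply K.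
Qed.

(** * The finite part from the truncated integral *)

Definition pole_sum (a : R) (b : C) (c : nat -> nat -> C) : C :=
  sum_pairs b (fun m n => if Ceq_dec (b + INR n * a + INR m + 1) 0 then 0
                          else c m n * (1 / (b + INR n * a + INR m + 1))).

Lemma CI_sum_pairs {Fa Fb : (R -> Prop) -> Prop} {FFa : Filter Fa} {FFb : Filter Fb}
  (b : C) (f : R -> nat -> nat -> C) (l : nat -> nat -> C) :
  (forall m n, CI (fun t => f t m n) Fa Fb (l m n)) ->
  CI (fun t => sum_pairs b (f t)) Fa Fb (sum_pairs b l).
Proof.
  intros H. unfold sum_pairs.
  assert (S1 : forall (g : R -> nat -> C) (l : nat -> C) k, (forall m, CI (fun t => g t m) Fa Fb (l m)) ->
     CI (fun t => sum_n (g t) k) Fa Fb (sum_n l k)).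
  { intros g l0 k Hg. induction k as [|k IH].
    - rewrite sum_O. apply (is_RInt_gen_ext (V := C_R_NormedModule) (fun t => g t 0%nat)); [|apply Hg].
      apply filter_forall. intros ab t _. now rewrite sum_O.
    - rewrite sum_Sn. apply (is_RInt_gen_ext (V := C_R_NormedModule) (fun t => sum_n (g t) k + g t (S k))).
      + apply filter_forall. intros ab t _. now rewrite sum_Sn.
      + apply (CI_plus (fun t => sum_n (g t) k) (fun t => g t (S k))); [exact IH|apply Hg]. }
  apply S1. intros m. apply (S1 (fun t n => f t m n) (fun n => l m n)). intros n. apply H.
Qed.

(** The terms of the square that are not singular have [Re mu > 0], where
    [mu = b + n a + m + 1], so by [CI_power] they move from the integral to the sum
    of the [c / mu]. *)
Lemma is_finite_part_intro (a : R) (b p q : C) (g : R -> C) (c : nat -> nat -> C) (I1 I0 : C) :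
  (forall t, g t = fexp a p q t) -> (forall m n, c m n = coef p q m n) ->
  CI (fun t => Rcpow t b * fexp a p q t) (at_point 1%R) (Rbar_locally p_infty) I1 ->
  CI (fun t => Rcpow t b * (fexp a p q t - trunc a b p q t)) (at_right 0%R) (at_point 1%R) I0 ->
  is_finite_part a b g c (I1 + I0 + pole_sum a b c).
Proof.
  intros Hg Hc H1 H0.
  set (reg := sum_pairs b (fun m n =>
    if Rle_dec (INR m + INR n * a + Re b)%R (-1)%R then 0
    else c m n * (1 / (b + INR n * a + INR m + 1)))).
  exists I1, (I0 + reg). split; [|split].
  - apply (CI_ext (fun t => Rcpow t b * fexp a p q t)); [|exact H1].
    apply filter_prod_one_infty. intros x Hx. simpl. split; [exact Hx|]. intros t _. now rewrite Hg.
  - apply (CI_ext (fun t => Rcpow t b * (fexp a p q t - trunc a b p q t) +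
      sum_pairs b (fun m n => if Rle_dec (INR m + INR n * a + Re b)%R (-1)%R then 0
        else c m n * (Cexp ((b + INR n * a + INR m + 1) * ln t) * (/ t)%R)))).
    + apply filter_prod_zero_one. intros x Hx. simpl. split; [lra|]. intros t Ht.
      assert (Ht0 : (0 < t)%R) by lra.
      rewrite trunc_sum, Hg by exact Ht0. unfold singular_sum.
      match goal with |- Rcpow t b * (_ - ?X) + ?Y = Rcpow t b * (_ - ?Z) =>
        cut (Y = Rcpow t b * (X - Z)); [intros ->; ring|] end.
      rewrite <- sum_pairs_minus, <- sum_pairs_scal. apply sum_pairs_ext. intros m n.
      rewrite <- Hc. destruct Rle_dec; [ring|].
      unfold Rcpow. rewrite Rpower_C, RtoC_inv_exp by exact Ht0.
      replace ((b + INR n * a + INR m + 1) * ln t)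
        with (b * ln t + ((INR n * a + INR m)%R * ln t + ln t)) by (rewrite RtoC_plus, RtoC_mult; ring).
      rewrite !Cexp_plus. rewrite RtoC_opp.
      assert (E : Cexp (ln t) * Cexp (- ln t) = 1) by (rewrite <- Cexp_plus, Cplus_opp_r; apply Cexp_0).
      replace (c m n * (Cexp (b * ln t) * (Cexp ((INR n * a + INR m)%R * ln t) * Cexp (ln t)) * Cexp (- ln t)))
        with (c m n * Cexp (b * ln t) * Cexp ((INR n * a + INR m)%R * ln t) * (Cexp (ln t) * Cexp (- ln t))) by ring.
      rewrite E. ring.
    + apply CI_plus; [exact H0|].
      apply CI_sum_pairs. intros m n. destruct Rle_dec as [L|L].
      * assert (K : CI (fun t => 0 * (Cexp (1 * ln t) * (/ t)%R)) (at_right 0%R) (at_point 1%R) (0 * / 1))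
          by (apply CI_Cmult, CI_power; simpl; lra).
        rewrite Cmult_0_l in K. revert K. apply CI_ext.
        apply filter_prod_zero_one. intros x Hx. simpl. split; [lra|]. intros t Ht. ring.
      * apply CI_Cmult. unfold Cdiv. rewrite Cmult_1_l. apply CI_power.
        simpl. apply Rnot_le_lt in L. unfold Re in L. simpl. lra.
  - unfold pole_sum, reg, singular_sum', singular_sum.
    rewrite <- !Cplus_assoc. do 2 f_equal. rewrite <- sum_pairs_plus.
    apply sum_pairs_ext. intros m n.
    destruct Rle_dec as [L|L]; destruct Ceq_dec as [E|E]; try ring.
    exfalso. apply L. apply (f_equal Re) in E. simpl in E. unfold Re in *. simpl in *. lra.
Qed.

(** * Decay of the integrands *)

Lemma linear_sub_power_bounded (a K : R) : (1 < a)%R ->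
  exists c, (0 <= c)%R /\ forall t, (1 <= t)%R -> (K * t - Rpower t a <= c)%R.
Proof.
  (* For t >= T = L^(1/(a - 1)) one has t^(a - 1) >= L >= K; below T the term K t is at most L T. *)
  intros Ha. set (L := Rmax K 1). set (T := Rpower L (/ (a - 1))).
  assert (L1 : (1 <= L)%R) by apply Rmax_r. assert (LK : (K <= L)%R) by apply Rmax_l.
  assert (HT : (0 < T)%R) by apply exp_pos.
  exists (L * T)%R. split; [nra|]. intros t Ht.
  assert (Pt : (0 < Rpower t a)%R) by apply exp_pos.
  destruct (Rle_dec t T) as [H|H]; [nra|]. apply Rnot_le_lt in H.
  assert (E : Rpower t a = (t * Rpower t (a - 1))%R).
  { rewrite <- (Rpower_1 t) at 2 by lra. rewrite <- Rpower_plus. f_equal. ring. }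
  assert (G : (L <= Rpower t (a - 1))%R).
  { replace L with (Rpower T (a - 1)).
    - apply Rle_Rpower_l; lra.
    - unfold T. rewrite Rpower_mult. rewrite Rinv_l by lra. apply Rpower_1. lra. }
  rewrite E. nra.
Qed.

(** From [ln x <= x] at [x = (d / s) t], with [s = |r| + 1]. *)
Lemma log_sublinear (r d : R) : (0 < d)%R ->
  exists c, forall t, (1 <= t)%R -> (r * ln t <= d * t + c)%R.
Proof.
  intros Hd. set (s := (Rabs r + 1)%R).
  assert (Ps : (1 <= s)%R) by (unfold s; assert (A := Rabs_pos r); lra).
  exists (- (s * ln (d / s)))%R. intros t Ht.
  assert (L0 : (0 <= ln t)%R).
  { destruct Ht as [H| <-]; [|rewrite ln_1; lra]. left. rewrite <- ln_1. apply ln_increasing; lra. }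
  assert (H1 : (r * ln t <= s * ln t)%R).
  { apply Rmult_le_compat_r; [exact L0|]. unfold s. assert (A := Rle_abs r). lra. }
  assert (Pd : (0 < d / s)%R) by (apply Rdiv_lt_0_compat; lra).
  assert (H2 : (ln (d / s * t) <= d / s * t)%R).
  { assert (X : (0 < d / s * t)%R) by (apply Rmult_lt_0_compat; lra).
    assert (Y := exp_ineq1_le (ln (d / s * t))). rewrite exp_ln in Y by exact X. lra. }
  rewrite ln_mult in H2 by lra.
  assert (H3 : (s * (ln (d / s) + ln t) <= s * (d / s * t))%R) by (apply Rmult_le_compat_l; lra).
  replace (s * (d / s * t))%R with (d * t)%R in H3 by (field; lra). lra.
Qed.

Lemma Cmod_Rcpow_fexp a b p q t :
  Cmod (Rcpow t b * fexp a p q t) = exp (Re b * ln t + (Re p * Rpower t a + Re q * t)).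
Proof.
  unfold fexp. rewrite Cmod_mult, Cmod_Rcpow, Cmod_Cexp, <- exp_plus. f_equal. f_equal.
  destruct p, q; simpl. ring.
Qed.

Lemma Re_rotated_Ci (x : R) : Re (Ci * Cexp (x * Ci)) = (- sin x)%R.
Proof.
  unfold Cexp; simpl.
  replace (x * 0 - 0 * 1)%R with 0%R by ring. replace (x * 1 + 0 * 0)%R with x by ring.
  rewrite exp_0. ring.
Qed.

Lemma Re_rotated_z (z : C) (x : R) :
  Re (- Ci * z * Cexp (x * Ci)) = (Im z * cos x + Re z * sin x)%R.
Proof.
  destruct z as [z1 z2]. unfold Cexp; simpl.
  replace (x * 0 - 0 * 1)%R with 0%R by ring. replace (x * 1 + 0 * 0)%R with x by ring.
  rewrite exp_0. ring.
Qed.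

(** The exponent has real part
    [- sin (a ph) t^a + (Im z cos ph + Re z sin ph) t].  As [sin ph <= sin (a ph)],
    the terms with a sine are at most [sin ph (|z| t - t^a)], which is bounded above
    uniformly in [ph]; the cosine term decays since [cos ph >= cos th > 0] and
    [Im z < 0]. *)
Lemma oscillatory_decay (a : R) (b z : C) : (1 < a)%R -> (Im z < 0)%R ->
  exists c d, (0 < d)%R /\ forall t ph, (1 <= t)%R -> (0 <= ph <= PI / (2 * a))%R ->
    (Cmod (Rcpow t b * fexp a (Ci * Cexp (a * (ph * Ci))) (- Ci * z * Cexp (ph * Ci)) t)
      <= c * exp (- d * t))%R.
Proof.
  intros Ha Hz. set (th := (PI / (2 * a))%R).
  assert (PP := PI_RGT_0).
  assert (Hth : (a * th = PI / 2)%R) by (unfold th; field; lra).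
  assert (th0 : (0 < th)%R) by (apply Rdiv_lt_0_compat; lra).
  assert (th2 : (th < PI / 2)%R) by nra.
  assert (Cth : (0 < cos th)%R) by (apply cos_gt_0; lra).
  set (d := (- Im z * cos th / 2)%R).
  assert (Hd : (0 < d)%R) by (unfold d; nra).
  destruct (linear_sub_power_bounded a (Cmod z) Ha) as [C0 [C0p HC0]].
  destruct (log_sublinear (Re b) d Hd) as [C1 HC1].
  exists (exp (C0 + C1)), d. split; [exact Hd|]. intros t ph Ht Hph.
  rewrite Cmod_Rcpow_fexp, <- exp_plus. apply exp_le.
  replace (a * (ph * Ci)) with ((a * ph)%R * Ci) by (rewrite RtoC_mult; ring).
  rewrite Re_rotated_Ci, Re_rotated_z.
  assert (aph : (ph <= a * ph <= PI / 2)%R) by (split; nra).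
  assert (S0 : (0 <= sin ph)%R) by (apply sin_ge_0; lra).
  assert (S1 : (sin ph <= 1)%R) by apply SIN_bound.
  assert (S2 : (sin ph <= sin (a * ph))%R) by (apply sin_incr_1; lra).
  assert (C2 : (cos th <= cos ph)%R) by (apply cos_decr_1; lra).
  assert (Pt : (0 < Rpower t a)%R) by apply exp_pos.
  assert (Rz : (Re z <= Cmod z)%R) by (eapply Rle_trans; [apply Rle_abs|apply Cmod_fst]).
  specialize (HC0 t Ht). specialize (HC1 t Ht).
  assert (X1 : (- sin (a * ph) * Rpower t a <= - sin ph * Rpower t a)%R) by nra.
  assert (X2 : (Im z * cos ph * t <= Im z * cos th * t)%R).
  { apply Rmult_le_compat_r; [lra|]. nra. }
  assert (X3 : (Re z * sin ph * t <= Cmod z * sin ph * t)%R).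
  { apply Rmult_le_compat_r; [lra|]. now apply Rmult_le_compat_r. }
  assert (X4 : (sin ph * (Cmod z * t - Rpower t a) <= C0)%R).
  { apply Rle_trans with (sin ph * C0)%R; [now apply Rmult_le_compat_l|nra]. }
  assert (X5 : (Im z * cos th * t = - (2 * d) * t)%R) by (unfold d; field).
  lra.
Qed.

(** Here [exp (- t^a)] dominates for every [q], uniformly on discs. *)
Lemma rotated_decay (a : R) (b : C) (Q : R) : (1 < a)%R ->
  exists c, forall t q, (1 <= t)%R -> (Cmod q <= Q)%R ->
    (Cmod (Rcpow t b * fexp a (- (1)) q t) <= c * exp (- (1) * t))%R.
Proof.
  intros Ha.
  destruct (linear_sub_power_bounded a (Q + 2) Ha) as [C0 [C0p HC0]].
  destruct (log_sublinear (Re b) 1 Rlt_0_1) as [C1 HC1].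
  exists (exp (C0 + C1)). intros t q Ht Hq.
  rewrite Cmod_Rcpow_fexp, <- exp_plus. apply exp_le.
  specialize (HC0 t Ht). specialize (HC1 t Ht).
  assert (Rq : (Re q <= Q)%R).
  { eapply Rle_trans; [apply Rle_abs|]. eapply Rle_trans; [apply Cmod_fst|exact Hq]. }
  assert (Re q * t <= Q * t)%R by (apply Rmult_le_compat_r; lra).
  replace (Re (- (1))) with (- (1))%R by (simpl; ring). lra.
Qed.

(** * Holomorphy in the parameter *)

Definition holo (f : C -> C) : Prop := forall w, exists l, hol f w l.
Lemma holo_const c : holo (fun _ => c).
Proof. intros w. eexists. apply hol_const. Qed.
Lemma holo_id : holo (fun w => w).
Proof. intros w. eexists. apply hol_id. Qed.
Lemma holo_plus f g : holo f -> holo g -> holo (fun w => f w + g w).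
Proof. intros Hf Hg w. destruct (Hf w), (Hg w). eexists. apply hol_plus; eassumption. Qed.
Lemma holo_mult f g : holo f -> holo g -> holo (fun w => f w * g w).
Proof. intros Hf Hg w. destruct (Hf w), (Hg w). eexists. apply hol_mult; eassumption. Qed.
Lemma holo_comp f g : holo f -> holo g -> holo (fun w => f (g w)).
Proof. intros Hf Hg w. destruct (Hg w), (Hf (g w)). eexists. eapply hol_comp; eassumption. Qed.
Lemma holo_Cexp f : holo f -> holo (fun w => Cexp (f w)).
Proof. apply holo_comp. intros w. eexists. apply hol_Cexp. Qed.
Lemma holo_expsum k f : holo f -> holo (fun w => expsum k (f w)).
Proof. apply holo_comp. intros w. eexists. apply hol_expsum. Qed.
Lemma holo_pow n f : holo f -> holo (fun w => f w ^ n).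
Proof. apply (holo_comp (fun w => w ^ n)). intros w. eexists. apply hol_pow. Qed.
Lemma holo_ext f g : (forall w, f w = g w) -> holo f -> holo g.
Proof. intros E Hf w. destruct (Hf w) as [l Hl]. exists l. now apply (hol_ext f). Qed.

Ltac holo_tac := repeat match goal with
  | |- holo (fun w => ?c) => apply (holo_const c)
  | |- holo (fun w => w) => apply holo_id
  | |- holo (fun w => Cexp (@?f w)) => apply (holo_Cexp f); cbv beta
  | |- holo (fun w => expsum ?k (@?f w)) => apply (holo_expsum k f); cbv beta
  | |- holo (fun w => @?f w + @?g w) => apply (holo_plus f g); cbv beta
  | |- holo (fun w => @?f w * @?g w) => apply (holo_mult f g); cbv beta
  | |- holo (fun w => @?f w ^ ?k) => apply (holo_pow k f); cbv beta
  end.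

(** For [t > 0] every integrand is an entire function of [ln t], hence continuous. *)
Lemma continuous_ln_holo (H : C -> C) (t : R) :
  (0 < t)%R -> holo H -> Ccontinuous (fun s => H (ln s)) t.
Proof.
  intros Ht HH. destruct (HH (ln t + 0)) as [l Hl].
  apply (Ccontinuous_ext_pos (fun s => H (ln s + 0)) _ t Ht).
  { intros s _. now rewrite Cplus_0_r. }
  eapply curve_continuous. apply (hol_curve H (fun s => ln s + 0)); [exact Hl|now apply curve_ln].
Qed.

Lemma continuous_rem a b p j k q t : (0 < t)%R -> Ccontinuous (rem a b p j k q) t.
Proof.
  intros Ht.
  apply (Ccontinuous_ext_pos (fun s => (fun w => Cexp (b * w) * (Cexp w ^ j *
    (Cexp (p * Cexp (a * w) + q * Cexp w) + - (1) *
      (expsum (S (index_bound b)) (p * Cexp (a * w)) * expsum k (q * Cexp w))))) (ln s)) _ t Ht).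
  - intros s Hs. unfold rem, fexp, Rcpow. rewrite Rpower_C, (exp_ln_C s Hs). ring.
  - apply (continuous_ln_holo (fun w => Cexp (b * w) * (Cexp w ^ j *
    (Cexp (p * Cexp (a * w) + q * Cexp w) + - (1) *
      (expsum (S (index_bound b)) (p * Cexp (a * w)) * expsum k (q * Cexp w))))) t Ht).
    holo_tac.
Qed.

Lemma rem_whole a b p j q t : (0 < t)%R ->
  rem a b p j 0 q t = Rcpow t (b + INR j) * fexp a p q t.
Proof.
  intros Ht. unfold rem. simpl expsum at 2. rewrite (exp_ln_C t Ht) at 1.
  rewrite <- Cexp_INR_mul. unfold Rcpow.
  replace ((b + INR j) * ln t) with (b * ln t + INR j * ln t) by ring.
  rewrite Cexp_plus. ring.
Qed.

Lemma rem_whole_0 a b p q t : rem a b p 0 0 q t = Rcpow t b * fexp a p q t.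
Proof. unfold rem. simpl. ring. Qed.

Lemma rem_trunc_0 a b p q t :
  rem a b p 0 (S (index_bound b)) q t = Rcpow t b * (fexp a p q t - trunc a b p q t).
Proof. unfold rem, trunc. simpl (t ^ 0). ring. Qed.

Definition integral (f : R -> C) (Fa Fb : (R -> Prop) -> Prop) : C :=
  RInt_gen (V := C_R_CompleteNormedModule) f Fa Fb.

Lemma integral_correct {Fa Fb : (R -> Prop) -> Prop} {FFa : ProperFilter Fa} {FFb : ProperFilter Fb}
  (f : R -> C) : (exists l, CI f Fa Fb l) -> CI f Fa Fb (integral f Fa Fb).
Proof. intros H. apply (RInt_gen_correct (V := C_R_CompleteNormedModule)). exact H. Qed.

(** The index [j] is the order of differentiation in [q]. *)
Definition outer (a : R) (b p : C) (j : nat) (q : C) : C :=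
  integral (rem a b p j 0 q) (at_point 1%R) (Rbar_locally p_infty).
Definition inner (a : R) (b p : C) (j : nat) (q : C) : C :=
  integral (rem a b p j (S (index_bound b) - j) q) (at_right 0%R) (at_point 1%R).

Lemma CI_outer_rot a b j q : (1 < a)%R ->
  CI (rem a b (- (1)) j 0 q) (at_point 1%R) (Rbar_locally p_infty) (outer a b (- (1)) j q).
Proof.
  intros Ha. apply integral_correct.
  destruct (rotated_decay a (b + INR j) (Cmod q) Ha) as [c Hc].
  apply (ex_CI_infty _ c 1); [lra|]. intros t Ht. split; [apply continuous_rem; lra|].
  rewrite rem_whole by lra. apply Hc; lra.
Qed.

Lemma CI_outer_osc a b z (ph : R) : (1 < a)%R -> (Im z < 0)%R -> (0 <= ph <= PI / (2 * a))%R ->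
  let p := Ci * Cexp (a * (ph * Ci)) in let q := - Ci * z * Cexp (ph * Ci) in
  CI (rem a b p 0 0 q) (at_point 1%R) (Rbar_locally p_infty) (outer a b p 0 q).
Proof.
  intros Ha Hz Hph p q. apply integral_correct.
  destruct (oscillatory_decay a b z Ha Hz) as [c [d [Hd Hc]]].
  apply (ex_CI_infty _ c d Hd). intros t Ht. split; [apply continuous_rem; lra|].
  rewrite rem_whole_0. now apply Hc.
Qed.

Lemma CI_inner a b p j q : (1 < a)%R ->
  CI (rem a b p j (S (index_bound b) - j) q) (at_right 0%R) (at_point 1%R) (inner a b p j q).
Proof.
  intros Ha. apply integral_correct.
  destruct (rem_bound a b j (S (index_bound b) - j) (Cmod p) (Cmod q)) as [M [M0 HM]];
    [exact Ha|apply Cmod_ge_0|apply Cmod_ge_0|lia|].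
  apply (ex_CI_zero _ M). intros t Ht. split; [apply continuous_rem; lra|].
  eapply Rle_trans; [apply HM; [lra|lra|exact Ht]|]. nra.
Qed.

Lemma rem_taylor1 a b p k q h t M :
  (forall q', (Cmod q' <= Cmod q + 1)%R -> (Cmod (rem a b p 2 (pred (pred k)) q' t) <= M)%R) ->
  (Cmod h <= 1)%R ->
  (Cmod (rem a b p 0 k (q + h) t - rem a b p 0 k q t - rem a b p 1 (pred k) q t * h)%C
    <= M * (Cmod h * Cmod h))%R.
Proof.
  intros HM Hh.
  apply (hol_taylor1 (fun q => rem a b p 0 k q t) (fun q => rem a b p 1 (pred k) q t)
    (fun q => rem a b p 2 (pred (pred k)) q t)).
  intros u Hu. split; [apply hol_rem|split; [apply hol_rem|]].
  apply HM. eapply Rle_trans; [apply Cmod_triangle|].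
  assert (L := Cmod_segment_le u h Hu). lra.
Qed.

(** The second derivative in [q] is the integrand for [b + 2], so [rotated_decay] on
    a disc of radius one larger dominates the error. *)
Lemma hol_outer a b q : (1 < a)%R ->
  hol (outer a b (- (1)) 0) q (outer a b (- (1)) 1 q).
Proof.
  intros Ha.
  destruct (rotated_decay a (b + INR 2) (Cmod q + 1) Ha) as [c Hc].
  apply (hol_integral (Fa := at_point 1%R) (Fb := Rbar_locally p_infty) (rem a b (- (1)) 0 0)
    (rem a b (- (1)) 1 0 q) _ _ q (fun t => c * exp (- (1) * t))%R (c * exp (- (1)) / 1)%R 1).
  - lra.
  - intros q'. now apply CI_outer_rot.
  - now apply CI_outer_rot.
  - apply is_RInt_gen_exp_infty. lra.
  - apply filter_prod_one_infty. intros y Hy. simpl. split; [exact Hy|]. intros t Ht h Hh.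
    apply (rem_taylor1 a b (- (1)) 0); [|exact Hh].
    intros q' Hq'. simpl pred. rewrite rem_whole by lra. apply Hc; [lra|exact Hq'].
Qed.

(** Two derivatives in [q] lower the order of the truncation by 2 and bring a
    factor [t^2], so the error remains bounded on the unit interval. *)
Lemma hol_inner a b p q : (1 < a)%R -> hol (inner a b p 0) q (inner a b p 1 q).
Proof.
  intros Ha. set (N := S (index_bound b)).
  destruct (rem_bound a b 2 (pred (pred N)) (Cmod p) (Cmod q + 1)) as [M [M0 HM]];
    [exact Ha|apply Cmod_ge_0|assert (A := Cmod_ge_0 q); lra|unfold N; simpl; lia|].
  apply (hol_integral (Fa := at_right 0%R) (Fb := at_point 1%R) (rem a b p 0 N)
    (rem a b p 1 (pred N) q) _ _ q (fun _ => M) M 1).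
  - lra.
  - intros q'. apply (CI_inner a b p 0 q' Ha).
  - replace (pred N) with (N - 1)%nat by lia. now apply CI_inner.
  - apply is_RInt_gen_const_zero.
  - apply filter_prod_zero_one. intros y Hy. simpl. split; [lra|]. intros t Ht h Hh.
    apply rem_taylor1; [|exact Hh]. intros q' Hq'.
    eapply Rle_trans; [apply HM; [lra|exact Hq'|lra]|]. nra.
Qed.

(** * Rotation of the half-line *)

Definition kdiff (a : R) (b p q w : C) : C := kexp a (b + 1) p q w + - (1) * ktrunc a b p q w.

Lemma smooth_kdiff a b p q : smooth (kdiff a b p q).
Proof. apply smooth_plus; [apply smooth_kexp|apply smooth_scal, smooth_ktrunc]. Qed.

Lemma kexp_rem a b p q (t ph : R) : (0 < t)%R ->
  kexp a (b + 1) p q (ln t + ph * Ci) =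
  t * (Cexp ((b + 1) * (ph * Ci)) * rem a b (p * Cexp (a * (ph * Ci))) 0 0 (q * Cexp (ph * Ci)) t).
Proof. intros Ht. now rewrite rem_whole_0, kexp_log. Qed.

Lemma kdiff_rem a b p q (t ph : R) : (0 < t)%R ->
  kdiff a b p q (ln t + ph * Ci) =
  t * (Cexp ((b + 1) * (ph * Ci)) *
    rem a b (p * Cexp (a * (ph * Ci))) 0 (S (index_bound b)) (q * Cexp (ph * Ci)) t).
Proof. intros Ht. unfold kdiff. rewrite rem_trunc_0, kexp_log, ktrunc_log by exact Ht. ring. Qed.

Lemma Cmod_Cexp_Ci (x : R) : Cmod (Cexp (x * Ci)) = 1%R.
Proof.
  rewrite Cmod_Cexp. simpl. replace (x * 0 - 0 * 1)%R with 0%R by ring. apply exp_0.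
Qed.

Lemma Cmod_Ci : Cmod Ci = 1%R.
Proof.
  unfold Cmod; simpl. replace (0 * (0 * 1) + 1 * (1 * 1))%R with 1%R by ring. apply sqrt_1.
Qed.

Lemma Cmod_rotation_factor (b : C) (th ph : R) : (0 <= ph <= th)%R ->
  (Cmod (Cexp ((b + 1) * (ph * Ci))) <= exp (th * Rabs (Im b)))%R.
Proof.
  intros Hph. rewrite Cmod_Cexp. apply exp_le.
  replace (Re ((b + 1) * (ph * Ci))) with (ph * - Im b)%R by (destruct b; simpl; ring).
  assert (A := Rle_abs (- Im b)). rewrite Rabs_Ropp in A.
  assert (B := Rabs_pos (Im b)). nra.
Qed.

Lemma exp_decay_small (c d eta : R) : (0 < d)%R -> (0 < eta)%R ->
  exists X, forall y, (X <= y)%R -> (c * exp (- d * y) <= eta)%R.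
Proof.
  intros Hd He.
  destruct (exp_decay_lim c d Hd (fun u => (u < eta)%R)) as [M HM].
  { exists (mkposreal eta He). intros y Hy.
    unfold ball in Hy; simpl in Hy; unfold AbsRing_ball, abs, minus, plus, opp in Hy; simpl in Hy.
    apply Rabs_def2 in Hy. lra. }
  exists (M + 1)%R. intros y Hy. left. apply HM. lra.
Qed.

Lemma kexp_decay (a : R) (b z : C) : (1 < a)%R -> (Im z < 0)%R ->
  forall eta, (0 < eta)%R -> exists X, forall y, (X <= y)%R ->
    forall ph, (0 <= ph <= PI / (2 * a))%R ->
    (Cmod (kexp a (b + 1) Ci (- Ci * z) (ln y + ph * Ci)%C) <= eta)%R.
Proof.
  intros Ha Hz eta He.
  destruct (oscillatory_decay a (b + INR 1) z Ha Hz) as [c [d [Hd Hc]]].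
  set (K := exp (PI / (2 * a) * Rabs (Im b))).
  assert (HK : (0 < K)%R) by apply exp_pos.
  destruct (exp_decay_small (K * c) d eta Hd He) as [X HX].
  exists (Rmax X 1). intros y Hy ph Hph.
  assert (Y1 : (1 <= y)%R) by (eapply Rle_trans; [apply Rmax_r|exact Hy]).
  assert (Y2 : (X <= y)%R) by (eapply Rle_trans; [apply Rmax_l|exact Hy]).
  rewrite kexp_rem by lra. rewrite Cmult_assoc, (Cmult_comm y), <- Cmult_assoc, Cmod_mult.
  replace (y * rem a b (Ci * Cexp (a * (ph * Ci))) 0 0 (- Ci * z * Cexp (ph * Ci)) y)
    with (rem a b (Ci * Cexp (a * (ph * Ci))) 1 0 (- Ci * z * Cexp (ph * Ci)) y)
    by (unfold rem; simpl; ring).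
  rewrite rem_whole by lra.
  eapply Rle_trans; [|apply (HX y Y2)]. rewrite Rmult_assoc.
  apply Rmult_le_compat; [apply Cmod_ge_0|apply Cmod_ge_0| |now apply Hc].
  now apply Cmod_rotation_factor.
Qed.

Lemma kdiff_small (a : R) (b z : C) (th : R) : (1 < a)%R ->
  forall eta, (0 < eta)%R -> exists X, (0 < X)%R /\ forall y, (0 < y <= X)%R ->
    forall ph, (0 <= ph <= th)%R ->
    (Cmod (kdiff a b Ci (- Ci * z) (ln y + ph * Ci)%C) <= eta)%R.
Proof.
  intros Ha eta He.
  destruct (rem_bound a b 0 (S (index_bound b)) 1 (Cmod (- Ci * z)) Ha) as [M [M0 HM]];
    [lra|apply Cmod_ge_0|lia|].
  set (K := exp (th * Rabs (Im b))).
  assert (HK : (0 < K)%R) by apply exp_pos.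
  exists (Rmin 1 (eta / (K * M + 1)))%R.
  assert (KM : (0 <= K * M)%R) by nra.
  split; [apply Rmin_pos; [lra|apply Rdiv_lt_0_compat; lra]|].
  intros y [Y0 Y] ph Hph.
  assert (Y1 : (y <= 1)%R) by (eapply Rle_trans; [exact Y|apply Rmin_l]).
  assert (Y2 : (y <= eta / (K * M + 1))%R) by (eapply Rle_trans; [exact Y|apply Rmin_r]).
  apply Rle_div_r in Y2; [|lra].
  rewrite kdiff_rem by exact Y0. rewrite !Cmod_mult, Cmod_R, Rabs_pos_eq by lra.
  assert (R1 := Cmod_rotation_factor b th ph Hph). fold K in R1.
  assert (R2 : (Cmod (rem a b (Ci * Cexp (a * (ph * Ci))) 0 (S (index_bound b))
                 (- Ci * z * Cexp (ph * Ci)) y) <= M * y)%R).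
  { apply HM; [| |lra].
    - replace (a * (ph * Ci)) with ((a * ph)%R * Ci) by (rewrite RtoC_mult; ring).
      rewrite Cmod_mult, Cmod_Ci, Cmod_Cexp_Ci. lra.
    - rewrite (Cmod_mult (- Ci * z)), Cmod_Cexp_Ci. lra. }
  assert (R3 : (Cmod (Cexp ((b + 1) * (ph * Ci))) * Cmod (rem a b (Ci * Cexp (a * (ph * Ci))) 0 (S (index_bound b))
                 (- Ci * z * Cexp (ph * Ci)) y) <= K * (M * y))%R).
  { apply Rmult_le_compat; auto using Cmod_ge_0. }
  assert (R4 : (K * (M * y) <= eta)%R) by nra.
  assert (0 <= Cmod (Cexp ((b + 1) * (ph * Ci))) * Cmod (rem a b (Ci * Cexp (a * (ph * Ci))) 0 (S (index_bound b))
                 (- Ci * z * Cexp (ph * Ci)) y))%R by (apply Rmult_le_pos; apply Cmod_ge_0).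
  nra.
Qed.

(** Only for [mu = 0] does the arc integral differ from the increment of
    [t^mu / mu]: it is then the increment of the logarithm. *)
Lemma CRInt_Cexp_arc (mu : C) (th : R) :
  CRInt (fun ph : R => Ci * Cexp (mu * (ph * Ci))) 0%R th
    (if Ceq_dec mu 0 then th * Ci else (Cexp (mu * (th * Ci)) - 1) * (1 / mu)).
Proof.
  destruct (Ceq_dec mu 0) as [E|E].
  - rewrite E. replace (th * Ci) with (th * Ci - 0%R * Ci) by ring.
    apply (is_RInt_ext (V := C_R_NormedModule) (fun _ => Ci)).
    { intros ph _. rewrite Cmult_0_l, Cexp_0. now rewrite Cmult_1_r. }
    apply (CRInt_FTC (fun ph : R => ph * Ci)). intros t _. split; [apply curve_scal_line|].
    apply (continuous_const (U := R_UniformSpace) (V := C_UniformSpace)).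
  - replace ((Cexp (mu * (th * Ci)) - 1) * (1 / mu))
      with (/ mu * Cexp (mu * (th * Ci)) - / mu * Cexp (mu * (0%R * Ci))).
    2:{ rewrite Cmult_0_l, Cmult_0_r, Cexp_0. field. exact E. }
    apply (CRInt_FTC (fun ph : R => / mu * Cexp (mu * (ph * Ci)))). intros t _. split.
    + replace (Ci * Cexp (mu * (t * Ci))) with (/ mu * (mu * Cexp (mu * (t * Ci))) * Ci) by (field; exact E).
      apply (hol_curve (fun w => / mu * Cexp (mu * w)) (fun ph : R => ph * Ci)); [|apply curve_scal_line].
      apply hol_scal, hol_Cexp_scal.
    + eapply curve_continuous.
      apply (hol_curve (fun w => Ci * Cexp (mu * w)) (fun ph : R => ph * Ci)); [|apply curve_scal_line].
      apply hol_scal, hol_Cexp_scal.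
Qed.

Lemma CRInt_ktrunc_arc (a : R) b p q (th : R) :
  CRInt (fun ph : R => Ci * ktrunc a b p q (ph * Ci)) 0%R th
    (sum_pairs b (fun m n => coef p q m n *
       (if Ceq_dec (b + INR n * a + INR m + 1) 0 then th * Ci
        else (Cexp ((b + INR n * a + INR m + 1) * (th * Ci)) - 1) * (1 / (b + INR n * a + INR m + 1))))).
Proof.
  apply (is_RInt_ext (V := C_R_NormedModule) (fun ph : R => sum_pairs b (fun m n =>
    coef p q m n * (Ci * Cexp ((b + INR n * a + INR m + 1) * (ph * Ci)))))).
  { intros ph _. rewrite ktrunc_sum, <- sum_pairs_scal. apply sum_pairs_ext. intros; ring. }
  apply is_RInt_gen_at_point.
  apply (CI_sum_pairs b (fun ph m n => coef p q m n * (Ci * Cexp ((b + INR n * a + INR m + 1) * (RtoC ph * Ci))))).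
  intros m n. apply CI_Cmult. apply is_RInt_gen_at_point. apply CRInt_Cexp_arc.
Qed.

Lemma coef_rotated (a : R) b p q m n (th : R) :
  Cexp ((b + 1) * (th * Ci)) * coef (p * Cexp (a * (th * Ci))) (q * Cexp (th * Ci)) m n =
  coef p q m n * Cexp ((b + INR n * a + INR m + 1) * (th * Ci)).
Proof.
  rewrite coef_Cexp.
  replace ((b + INR n * a + INR m + 1) * (th * Ci))
    with ((b + 1) * (th * Ci) + (INR n * a + INR m) * (th * Ci)) by ring.
  rewrite Cexp_plus. ring.
Qed.

(** Turning the ray multiplies the coefficient [c] of a term by [e^(i mu th)].  For
    [mu <> 0] the arc integral accounts for the change of [c / mu]; the terms with
    [mu = 0] have no [c / mu], and leave the resonant sum. *)
Lemma pole_sum_rotated (a : R) b p q (th : R) :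
  sum_pairs b (fun m n => coef p q m n *
    (if Ceq_dec (b + INR n * a + INR m + 1) 0 then th * Ci
     else (Cexp ((b + INR n * a + INR m + 1) * (th * Ci)) - 1) * (1 / (b + INR n * a + INR m + 1))))
  + pole_sum a b (coef p q) =
  Cexp ((b + 1) * (th * Ci)) * pole_sum a b (coef (p * Cexp (a * (th * Ci))) (q * Cexp (th * Ci)))
  + resonant_sum a b (fun m n => coef p q m n * (th * Ci)).
Proof.
  unfold pole_sum, resonant_sum. rewrite <- sum_pairs_scal, <- !sum_pairs_plus.
  apply sum_pairs_ext. intros m n.
  destruct (Ceq_dec (b + INR n * a + INR m + 1) 0) as [E|E];
    destruct (Ceq_dec (INR m + INR n * a + b + 1) 0) as [E'|E'].
  - ring.
  - exfalso. apply E'. rewrite <- E. ring.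
  - exfalso. apply E. rewrite <- E'. ring.
  - transitivity (coef p q m n * Cexp ((b + INR n * a + INR m + 1) * (th * Ci))
                  * (1 / (b + INR n * a + INR m + 1))); [ring|].
    rewrite <- coef_rotated. ring.
Qed.

Lemma rotated_difference k f0 f1 (e : C) (th t : R) : (0 < t)%R ->
  k (ln t + th * Ci) = t * (e * f1) -> k (ln t + 0%R * Ci) = t * f0 ->
  e * f1 - f0 = k (ln t + th * Ci) * (/ t)%R - k (ln t) * (/ t)%R.
Proof.
  intros Ht E1 E0. rewrite Cmult_0_l, Cplus_0_r in E0. rewrite E0, E1.
  rewrite RtoC_inv by lra. field. intros E. apply RtoC_inj in E. lra.
Qed.

(** The two unknown integrals of [kexp] over the unit arc, one from each end,
    cancel, and [pole_sum_rotated] evaluates what remains. *)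
Lemma rotation (a : R) (b z : C) : (1 < a)%R -> (Im z < 0)%R ->
  let th := (PI / (2 * a))%R in
  let p1 := Ci * Cexp (a * (th * Ci)) in let q1 := - Ci * z * Cexp (th * Ci) in
  outer a b Ci 0 (- Ci * z) + inner a b Ci 0 (- Ci * z) + pole_sum a b (coef Ci (- Ci * z)) =
  Cexp ((b + 1) * (th * Ci)) * (outer a b p1 0 q1 + inner a b p1 0 q1 + pole_sum a b (coef p1 q1))
  + resonant_sum a b (fun m n => coef Ci (- Ci * z) m n * (th * Ci)).
Proof.
  intros Ha Hz th p1 q1. set (e := Cexp ((b + 1) * (th * Ci))). set (q := - Ci * z) in *.
  assert (th0 : (0 <= th)%R).
  { unfold th. assert (P := PI_RGT_0). left. apply Rdiv_lt_0_compat; lra. }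
  assert (U : forall p : C, p * Cexp (a * (0%R * Ci)) = p).
  { intros p. rewrite Cmult_0_l, Cmult_0_r, Cexp_0. ring. }
  assert (V : q * Cexp (0%R * Ci) = q) by (rewrite Cmult_0_l, Cexp_0; ring).
  assert (Eb : Cexp ((b + 1) * (0%R * Ci)) = 1) by (rewrite Cmult_0_l, Cmult_0_r; apply Cexp_0).
  assert (O0 : CI (rem a b Ci 0 0 q) (at_point 1%R) (Rbar_locally p_infty) (outer a b Ci 0 q)).
  { assert (K := CI_outer_osc a b z 0 Ha Hz (conj (Rle_refl 0) th0)). cbv zeta in K. fold q in K.
    rewrite U, V in K. exact K. }
  assert (O1 : CI (rem a b p1 0 0 q1) (at_point 1%R) (Rbar_locally p_infty) (outer a b p1 0 q1)).
  { apply (CI_outer_osc a b z th Ha Hz). exact (conj th0 (Rle_refl th)). }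
  assert (I0 := CI_inner a b Ci 0 q Ha). assert (I1 := CI_inner a b p1 0 q1 Ha).
  assert (HW : exists W, CRInt (fun ph : R => Ci * kexp a (b + 1) Ci q (ph * Ci)) 0%R th W).
  { apply ex_CRInt. intros t _. destruct (smooth_kexp a (b + 1) Ci q) as [k1 [k2 [H1 _]]].
    eapply curve_continuous.
    apply (hol_curve (fun w => Ci * kexp a (b + 1) Ci q w) (fun ph : R => ph * Ci)); [|apply curve_scal_line].
    apply hol_scal, H1. }
  destruct HW as [W HW].
  assert (HT := CRInt_ktrunc_arc a b Ci q th).
  match type of HT with CRInt _ _ _ ?X => set (WT := X) in * end.
  assert (Einf : e * outer a b p1 0 q1 - outer a b Ci 0 q = - W).
  { apply (log_rotation_infty (kexp a (b + 1) Ci q) th);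
      [apply smooth_kexp|exact th0| |exact HW|now apply kexp_decay].
    apply (CI_ext (fun t => e * rem a b p1 0 0 q1 t - rem a b Ci 0 0 q t)).
    - apply filter_prod_one_infty. intros y Hy. simpl. split; [exact Hy|]. intros t Ht.
      apply rotated_difference; [lra|rewrite kexp_rem by lra; reflexivity|].
      rewrite kexp_rem, U, V, Eb by lra. ring.
    - apply CI_minus; [now apply CI_Cmult|exact O0]. }
  assert (Ezero : e * inner a b p1 0 q1 - inner a b Ci 0 q = W - WT).
  { apply (log_rotation_zero (kdiff a b Ci q) th);
      [apply smooth_kdiff|exact th0| | |now apply kdiff_small].
    - apply (CI_ext (fun t => e * rem a b p1 0 (S (index_bound b)) q1 t
                              - rem a b Ci 0 (S (index_bound b)) q t)).
      + apply filter_prod_zero_one. intros y Hy. simpl. split; [lra|]. intros t Ht.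
        apply rotated_difference; [lra|rewrite kdiff_rem by lra; reflexivity|].
        rewrite kdiff_rem, U, V, Eb by lra. ring.
      + apply CI_minus; [now apply CI_Cmult|exact I0].
    - apply (is_RInt_ext (V := C_R_NormedModule)
        (fun ph : R => Ci * kexp a (b + 1) Ci q (ph * Ci) - Ci * ktrunc a b Ci q (ph * Ci))).
      + intros ph _. unfold kdiff.
        assert (E : forall u v : C, Ci * u - Ci * v = Ci * (u + - (1) * v)) by (intros; ring). apply E.
      + now apply (is_RInt_minus (V := C_R_NormedModule)). }
  assert (P := pole_sum_rotated a b Ci q th). fold WT p1 q1 e in P.
  replace (outer a b Ci 0 q) with (e * outer a b p1 0 q1 + W)
    by (replace W with (- - W) by ring; rewrite <- Einf; ring).
  replace (inner a b Ci 0 q) with (e * inner a b p1 0 q1 - (W - WT)) by (rewrite <- Ezero; ring).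
  transitivity (e * outer a b p1 0 q1 + e * inner a b p1 0 q1 + (WT + pole_sum a b (coef Ci q))); [ring|].
  rewrite P. ring.
Qed.

(** * The entire continuation *)

Lemma entire_holo F : holo F -> entire F.
Proof. intros H z. destruct (H z) as [l Hl]. now exists l. Qed.

Lemma holo_sum_pairs b (f : C -> nat -> nat -> C) :
  (forall m n, holo (fun z => f z m n)) -> holo (fun z => sum_pairs b (f z)).
Proof. apply sum_pairs_ind; [apply holo_ext|apply holo_plus]. Qed.

Lemma holo_coef p c m n : holo (fun z => coef p (c * z) m n).
Proof.
  apply (holo_ext (fun z => (p ^ n / (INR (fact n) * INR (fact m))) * (c * z) ^ m)).
  - intros z. unfold coef. field. split; apply INR_fact_neq_0_C.
  - apply holo_mult; [apply holo_const|]. apply (holo_pow m (fun z => c * z)).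
    apply holo_mult; [apply holo_const|apply holo_id].
Qed.

Lemma Ci_quarter_turn (a : R) : (1 < a)%R -> Ci * Cexp (a * ((PI / (2 * a))%R * Ci)) = - (1).
Proof.
  intros Ha. rewrite Cmult_assoc, <- RtoC_mult.
  replace (a * (PI / (2 * a)))%R with (PI / 2)%R by (field; lra).
  unfold Cexp; simpl.
  replace (PI / 2 * 0 - 0 * 1)%R with 0%R by ring.
  replace (PI / 2 * 1 + 0 * 0)%R with (PI / 2)%R by ring.
  rewrite exp_0, cos_PI2, sin_PI2. unfold Ci, Cmult, Copp, RtoC; simpl. f_equal; ring.
Qed.

Theorem mainTheorem1 :
  forall (a : R) (b : C), (1 < a)%R ->
  exists F : C -> C,
    entire F /\
    (forall z : C, (Im z < 0)%R -> is_osc_FP a b z (F z)) /\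
    (forall z : C, exists B : C,
       is_rot_FP a b z B /\
       F z = Cexp (Ci * (b + 1) * PI / (2 * a)) * B
             + resonant_sum a b (fun m n => osc_coef z m n * (PI / (2 * a) * Ci))).
Proof.
  intros a b Ha. set (th := (PI / (2 * a))%R).
  assert (aC : RtoC a <> 0) by (intros E; apply RtoC_inj in E; lra).
  assert (Eth : RtoC th = PI / (2 * a)).
  { unfold th. rewrite RtoC_div, RtoC_mult by lra. reflexivity. }
  set (w := Cexp (th * Ci)).
  assert (Ew : Cexp (Ci * PI / (2 * a)) = w).
  { unfold w. rewrite Eth. f_equal. field; exact aC. }
  assert (Ee : Cexp (Ci * (b + 1) * PI / (2 * a)) = Cexp ((b + 1) * (th * Ci))).
  { rewrite Eth. f_equal. field; exact aC. }
  assert (Ecoef : forall z m n, rot_coef a z m n = coef (- (1)) (- Ci * w * z) m n).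
  { intros z m n. unfold rot_coef, coef.
    replace (Ci * INR m * PI / (2 * a)) with (INR m * (th * Ci)) by (rewrite Eth; field; exact aC).
    rewrite Cexp_INR_mul. fold w.
    replace (- Ci * w * z) with ((- Ci * z) * w) by ring.
    rewrite (Cpow_mult_l (- Ci * z) w). field. split; apply INR_fact_neq_0_C. }
  set (B := fun z => outer a b (- (1)) 0 (- Ci * w * z) + inner a b (- (1)) 0 (- Ci * w * z)
                     + pole_sum a b (rot_coef a z)).
  exists (fun z => Cexp (Ci * (b + 1) * PI / (2 * a)) * B z
             + resonant_sum a b (fun m n => osc_coef z m n * (PI / (2 * a) * Ci))).
  split; [|split].
  - apply entire_holo. apply holo_plus; [apply holo_mult; [apply holo_const|]|].
    + assert (Hl : holo (fun z => - Ci * w * z)) by (apply holo_mult; [apply holo_const|apply holo_id]).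
      apply holo_plus; [apply holo_plus|].
      * apply (holo_comp (outer a b (- (1)) 0)); [|exact Hl].
        intros q. eexists. now apply hol_outer.
      * apply (holo_comp (inner a b (- (1)) 0)); [|exact Hl].
        intros q. eexists. now apply hol_inner.
      * apply holo_sum_pairs. intros m n. destruct Ceq_dec; [apply holo_const|].
        apply holo_mult; [|apply holo_const].
        apply (holo_ext (fun z => coef (- (1)) (- Ci * w * z) m n)); [intros; now rewrite Ecoef|].
        apply holo_coef.
    + apply holo_sum_pairs. intros m n. destruct Ceq_dec; [|apply holo_const].
      apply holo_mult; [|apply holo_const]. apply (holo_coef Ci (- Ci)).
  - intros z Hz.
    assert (R := rotation a b z Ha Hz). cbv zeta in R. fold th in R.
    replace (Ci * Cexp (a * (th * Ci))) with (- (1)) in R by (symmetry; now apply Ci_quarter_turn).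
    fold w in R. replace (- Ci * z * w) with (- Ci * w * z) in R by ring.
    rewrite Ee, <- Eth. unfold B.
    replace (pole_sum a b (rot_coef a z)) with (pole_sum a b (coef (- (1)) (- Ci * w * z))).
    2:{ apply sum_pairs_ext. intros m n. now rewrite Ecoef. }
    change (osc_coef z) with (coef Ci (- Ci * z)). rewrite <- R.
    apply (is_finite_part_intro a b Ci (- Ci * z)).
    + intros t. unfold fexp. f_equal. ring.
    + reflexivity.
    + assert (K := CI_outer_osc a b z 0 Ha Hz). cbv zeta in K.
      rewrite !Cmult_0_l, Cmult_0_r, Cexp_0, !Cmult_1_r in K.
      apply (CI_ext (rem a b Ci 0 0 (- Ci * z))).
      * apply filter_prod_one_infty. intros y Hy. cbv beta; simpl fst; simpl snd. split; [exact Hy|]. intros t _. apply rem_whole_0.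
      * apply K. split; [lra|]. assert (P := PI_RGT_0). left. apply Rdiv_lt_0_compat; lra.
    + apply (CI_ext (rem a b Ci 0 (S (index_bound b)) (- Ci * z))).
      * apply filter_prod_zero_one. intros y Hy. cbv beta; simpl fst; simpl snd. split; [simpl; lra|]. intros t _. apply rem_trunc_0.
      * apply (CI_inner a b Ci 0 (- Ci * z) Ha).
  - intros z. exists (B z). split; [|reflexivity].
    apply (is_finite_part_intro a b (- (1)) (- Ci * w * z)).
    + intros t. unfold fexp. rewrite Ew. f_equal. ring.
    + apply Ecoef.
    + apply (CI_ext (rem a b (- (1)) 0 0 (- Ci * w * z))).
      * apply filter_prod_one_infty. intros y Hy. cbv beta; simpl fst; simpl snd. split; [exact Hy|]. intros t _. apply rem_whole_0.
      * now apply CI_outer_rot.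
    + apply (CI_ext (rem a b (- (1)) 0 (S (index_bound b)) (- Ci * w * z))).
      * apply filter_prod_zero_one. intros y Hy. cbv beta; simpl fst; simpl snd. split; [simpl; lra|]. intros t _. apply rem_trunc_0.
      * apply (CI_inner a b (- (1)) 0 (- Ci * w * z) Ha).
Qed.
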